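(* Assume (A1), (A2), (A4), (Ã3), (Ã5), that each $f_i$ is convex, and that $\psi=f+\phi$ is $\mu$-strongly convex with $\mu>0$ (with unique minimizer $x^\star$, $\psi^\star=\psi(x^\star)$). Consider Algorithm SNSPP with $S=\infty$, Option II, constant step sizes $\alpha_k^s=\alpha>0$ and constant batch sizes $b_k^s=b$. Let $\theta\in(0,\frac12)$ and $$\alpha\le\Big[L+\frac{\bar L}{b}\Big(\frac{4}{1-2\theta}+3\Big)\Big]^{-1},$$ and suppose the tolerances satisfy $\epsilon_k^s\le\delta_s\|F_{\mathrm{nat}}(\tilde x^s)\|$ for all $0\le k<m$, $s$, for a sequence $\delta_s>0$. Then there exist $\bar\delta>0$ and $\bar m\in\mathbb N$ (depending on the problem data, $\alpha$, $b$, $\theta$) such that, if $m\ge\bar m$ and $\delta_s\le\bar\delta$ for all $s$, then for all $s$ $$\mathbb{E}[\psi(\tilde x^{s+1})-\psi^\star]\le(1-\theta)\,\mathbb{E}[\psi(\tilde x^s)-\psi^\star].$$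
   Context: Problem: $\min_x\psi(x)=f(x)+\phi(x)$, $f(x)=\frac1N\sum_{i=1}^N f_i(A_ix)$, $A_i\in\mathbb{R}^{m_i\times n}$, $f_i:\mathbb{R}^{m_i}\to\mathbb{R}$ continuously differentiable, $\phi:\mathbb{R}^n\to(-\infty,\infty]$ proper closed convex. $\hat f_i(z)=f_i(z)+\frac{\gamma_i}{2}\|z\|^2$, $\hat f_i^\ast$ its conjugate, $\mathcal D_i=\operatorname{int}\operatorname{dom}\hat f_i^\ast$. Assumptions: (A1) each $f_i$ is $L_i$-smooth and $\gamma_i$-weakly convex; (A2) $\psi^\star:=\inf\psi>-\infty$; (A4) each $\hat f_i^\ast$ is essentially differentiable with locally Lipschitz gradient on $\mathcal D_i\ne\emptyset$; (Ã3) $\operatorname{prox}_{\alpha\phi}$ is $\nu$-order semismooth for all $\alpha>0$ ($0<\nu\le1$); (Ã5) each $\nabla\hat f_i^\ast$ is $\nu$-order semismooth on $\mathcal D_i$. (When all $f_i$ are convex one may take $\gamma_i=0$.) Notation: for a $b$-tuple $\mathcal S=(\kappa(1),\dots,\kappa(b))$ of elements of $[N]$: $f_{\mathcal S}(x)=\frac1b\sum_j f_{\kappa(j)}(A_{\kappa(j)}x)$, $\nabla f_{\mathcal S}(x)=\frac1b\sum_jA_{\kappa(j)}^\top\nabla f_{\kappa(j)}(A_{\kappa(j)}x)$, $M_{\mathcal S}=\frac1b\sum_j\gamma_{\kappa(j)}A_{\kappa(j)}^\top A_{\kappa(j)}$, $M_N=\frac1N\sum_i\gamma_iA_i^\top A_i$,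 $\mathcal A_{\mathcal S}=\frac1b(A_{\kappa(1)}^\top,\dots,A_{\kappa(b)}^\top)^\top$, $\mathcal D=\prod_j\mathcal D_{\kappa(j)}$, and for $\alpha>0$, $x,v\in\mathbb{R}^n$ the map $\mathcal V=(\mathcal V_1,\dots,\mathcal V_b)$, $\mathcal V_j(\xi)=\nabla\hat f^\ast_{\kappa(j)}(\xi_j)-A_{\kappa(j)}\operatorname{prox}_{\alpha\phi}(x-\alpha\mathcal A_{\mathcal S}^\top\xi+v)$, where $\operatorname{prox}_g(y)=\operatorname{argmin}_wg(w)+\frac12\|y-w\|^2$. Constants: $L$ = Lipschitz constant of $\nabla f$; $\bar L=\max_iL_i\|A_i\|^2$; $\bar A=\max_i\|A_i\|^2$; $\bar M=\max_i\gamma_i\cdot\bar A$; $\mu_\ast=\min_i1/(L_i+\gamma_i)$. $F^\alpha_{\mathrm{nat}}(x)=x-\operatorname{prox}_{\alpha\phi}(x-\alpha\nabla f(x))$, $F_{\mathrm{nat}}=F^1_{\mathrm{nat}}$. Algorithm SNSPP: inputs $\tilde x^0\in\mathbb{R}^n$, $m\in\mathbb N$, $S\in\mathbb N\cup\{\infty\}$, step sizes $\alpha_k^s>0$, batch sizes $b_k^s$, tolerances $\epsilon_k^s\ge0$. For $s=0,1,\dots,S$: set $x^{s,0}=\tilde x^s$; for $k=0,\dots,m-1$: draw a $b_k^s$-tuple $\mathcal S_k^s$ with entries i.i.d. uniform on $[N]$ (with replacement), independent of the past; set $v^{s,k}=\nabla f(\tilde x^s)-\nabla f_{\mathcal S_k^s}(\tilde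 x^s)$ and $\hat v^{s,k}=\alpha_k^s(v^{s,k}-M_{\mathcal S_k^s}x^{s,k})$; compute any $\xi^{s,k+1}\in\mathcal D$ with $\|\mathcal V(\xi^{s,k+1})\|\le\epsilon_k^s$, where $\mathcal V$ uses data $(\mathcal S,\alpha,x,v)=(\mathcal S_k^s,\alpha_k^s,x^{s,k},-\hat v^{s,k})$; set $x^{s,k+1}=\operatorname{prox}_{\alpha_k^s\phi}(x^{s,k}-\alpha_k^s\mathcal A_{\mathcal S_k^s}^\top\xi^{s,k+1}-\hat v^{s,k})$. Then Option I: $\tilde x^{s+1}=x^{s,m}$; Option II: $\tilde x^{s+1}=\frac1m\sum_{k=1}^mx^{s,k}$. Output: $\tilde x^{S+1}$ and $x_\pi$ drawn uniformly from $\{x^{s,k}:0\le k<m,\ 0\le s\le S\}$. *)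

(* Defs.v *)
From HB Require Import structures.
From mathcomp Require Import all_boot all_order all_algebra.
From mathcomp Require Import all_classical all_reals all_analysis.
Set Implicit Arguments. Unset Strict Implicit. Unset Printing Implicit Defensive.
Import Order.TTheory GRing.Theory Num.Theory.
Local Open Scope ring_scope.

Definition dotv {R : realType} {p : nat} (u v : 'cV[R]_p) : R :=
  \sum_(i < p) u i 0 * v i 0.
Definition vnorm {R : realType} {p : nat} (v : 'cV[R]_p) : R := Num.sqrt (dotv v v).
Definition mxnorm {R : realType} {p q : nat} (M : 'M[R]_(p, q)) : R :=
  Num.sqrt (\sum_(i < p) \sum_(j < q) M i j ^+ 2).
Definition opnorm {R : realType} {p q : nat} (M : 'M[R]_(p, q)) : R :=
  sup [set vnorm (M *m x) | x in [set x : 'cV[R]_q | vnorm x <= 1]].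

Definition cvg_vec {R : realType} {p : nat} (u : nat -> 'cV[R]_p) (y : 'cV[R]_p) : Prop :=
  forall e : R, 0 < e -> exists K : nat, forall k, (K <= k)%N -> vnorm (u k - y) < e.
Definition cvg_mat {R : realType} {p q : nat} (U : nat -> 'M[R]_(p, q)) (Y : 'M[R]_(p, q)) : Prop :=
  forall e : R, 0 < e -> exists K : nat, forall k, (K <= k)%N -> mxnorm (U k - Y) < e.

Definition has_grad {R : realType} {p : nat} (f : 'cV[R]_p -> R) (g : 'cV[R]_p -> 'cV[R]_p) : Prop :=
  forall z (e : R), 0 < e -> exists2 d : R, 0 < d &
    forall h, vnorm h < d -> `|f (z + h) - f z - dotv (g z) h| <= e * vnorm h.
Definition lipK {R : realType} {p q : nat} (F : 'cV[R]_p -> 'cV[R]_q) (K : R) : Prop :=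
  forall x y, vnorm (F x - F y) <= K * vnorm (x - y).
Definition convex_fun {R : realType} {p : nat} (f : 'cV[R]_p -> R) : Prop :=
  forall x y (t : R), 0 <= t <= 1 ->
    f (t *: x + (1 - t) *: y) <= t * f x + (1 - t) * f y.

Definition econvex {R : realType} {p : nat} (h : 'cV[R]_p -> \bar R) : Prop :=
  forall x y (t : R), 0 <= t <= 1 ->
    (h ((t *: x + (1 - t) *: y)%R) <= t%:E * h x + (1 - t)%R%:E * h y)%E.
Definition eproper {R : realType} {p : nat} (h : 'cV[R]_p -> \bar R) : Prop :=
  (forall x, h x != -oo%E) /\ exists x, h x \is a fin_num.
Definition elsc {R : realType} {p : nat} (h : 'cV[R]_p -> \bar R) : Prop :=
  forall x (t : R), (t%:E < h x)%E -> exists2 d : R, 0 < d &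
    forall y, vnorm (y - x) < d -> (t%:E < h y)%E.
Definition proper_closed_convex {R : realType} {p : nat} (h : 'cV[R]_p -> \bar R) : Prop :=
  [/\ eproper h, elsc h & econvex h].
Definition strongly_convex {R : realType} {p : nat} (mu : R) (h : 'cV[R]_p -> \bar R) : Prop :=
  forall x y (t : R), 0 <= t <= 1 ->
    (h ((t *: x + (1 - t) *: y)%R) <=
      t%:E * h x + (1 - t)%R%:E * h y - (mu / 2 * t * (1 - t) * vnorm (x - y) ^+ 2)%R%:E)%E.

Definition prox {R : realType} {p : nat} (a : R) (h : 'cV[R]_p -> \bar R) (y : 'cV[R]_p) : 'cV[R]_p :=
  xget y [set w | forall w',
    (a%:E * h w + (2^-1 * vnorm (y - w) ^+ 2)%R%:E <= a%:E * h w' + (2^-1 * vnorm (y - w') ^+ 2)%R%:E)%E].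

Definition fconj {R : realType} {p : nat} (f : 'cV[R]_p -> R) (y : 'cV[R]_p) : \bar R :=
  ereal_sup (range (fun z => (dotv y z - f z)%R%:E)).
Definition int_set {R : realType} {p : nat} (S : set 'cV[R]_p) : set 'cV[R]_p :=
  [set y | exists2 r : R, 0 < r & forall z, vnorm (z - y) < r -> S z].
Definition Ddom {R : realType} {p : nat} (f : 'cV[R]_p -> R) : set 'cV[R]_p :=
  int_set [set y | (fconj f y < +oo)%E].

(* essential differentiability (essential smoothness, Rockafellar Sec. 26) of h
   on D = int dom h, with gradient G there *)
Definition ess_diff {R : realType} {p : nat} (h : 'cV[R]_p -> \bar R)
    (G : 'cV[R]_p -> 'cV[R]_p) (D : set 'cV[R]_p) : Prop :=
  [/\ (exists y, D y),
      (forall y, D y -> h y \is a fin_num /\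
         forall e : R, 0 < e -> exists2 d : R, 0 < d & forall v, vnorm v < d ->
           `|fine (h (y + v)) - fine (h y) - dotv (G y) v| <= e * vnorm v) &
      (forall (u : nat -> 'cV[R]_p) y, (forall k, D (u k)) -> cvg_vec u y -> ~ D y ->
         forall M : R, exists K : nat, forall k, (K <= k)%N -> M <= vnorm (G (u k)))].
Definition loc_lip_on {R : realType} {p q : nat} (G : 'cV[R]_p -> 'cV[R]_q) (D : set 'cV[R]_p) : Prop :=
  forall y, D y -> exists2 r : R, 0 < r & exists K : R, forall z z',
    vnorm (z - y) < r -> vnorm (z' - y) < r -> vnorm (G z - G z') <= K * vnorm (z - z').

Definition frechetJ {R : realType} {p q : nat} (F : 'cV[R]_p -> 'cV[R]_q) (x : 'cV[R]_p)
    (J : 'M[R]_(q, p)) : Prop :=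
  forall e : R, 0 < e -> exists2 d : R, 0 < d &
    forall h, vnorm h < d -> vnorm (F (x + h) - F x - J *m h) <= e * vnorm h.
Definition Bsub {R : realType} {p q : nat} (F : 'cV[R]_p -> 'cV[R]_q) (x : 'cV[R]_p) : set 'M[R]_(q, p) :=
  [set J | exists (u : nat -> 'cV[R]_p) (Js : nat -> 'M[R]_(q, p)),
     [/\ forall k, frechetJ F (u k) (Js k), cvg_vec u x & cvg_mat Js J]].
Definition clarke {R : realType} {p q : nat} (F : 'cV[R]_p -> 'cV[R]_q) (x : 'cV[R]_p) : set 'M[R]_(q, p) :=
  [set J | exists (r : nat) (lam : 'I_r -> R) (Js : 'I_r -> 'M[R]_(q, p)),
     [/\ forall j, 0 <= lam j, \sum_j lam j = 1, forall j, Bsub F x (Js j)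
       & J = \sum_j lam j *: Js j]].
Definition dir_diff {R : realType} {p q : nat} (F : 'cV[R]_p -> 'cV[R]_q) (x : 'cV[R]_p) : Prop :=
  forall h : 'cV[R]_p, exists d : 'cV[R]_q, forall e : R, 0 < e -> exists2 t0 : R, 0 < t0 &
    forall t : R, 0 < t < t0 -> vnorm (t^-1 *: (F (x + t *: h) - F x) - d) <= e.
Definition semismooth_at {R : realType} {p q : nat} (nu : R) (F : 'cV[R]_p -> 'cV[R]_q) (x : 'cV[R]_p) : Prop :=
  [/\ (exists2 r : R, 0 < r & exists K : R, forall z z',
         vnorm (z - x) < r -> vnorm (z' - x) < r -> vnorm (F z - F z') <= K * vnorm (z - z')),
      dir_diff F x &
      exists C : R, exists2 d : R, 0 < d & forall h J, vnorm h < d -> clarke F (x + h) J ->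
         vnorm (F (x + h) - F x - J *m h) <= C * vnorm h `^ (1 + nu)].

Section Problem.
Context {R : realType} {n N : nat} {md : 'I_N -> nat}.
Implicit Types (A : forall i : 'I_N, 'M[R]_(md i, n))
  (f : forall i : 'I_N, 'cV[R]_(md i) -> R)
  (g : forall i : 'I_N, 'cV[R]_(md i) -> 'cV[R]_(md i)).

Definition fsum f A (x : 'cV[R]_n) : R := N%:R^-1 * \sum_(i < N) f i (A i *m x).
Definition gradf A g (x : 'cV[R]_n) : 'cV[R]_n :=
  N%:R^-1 *: \sum_(i < N) (A i)^T *m g i (A i *m x).
Definition psi f A (phi : 'cV[R]_n -> \bar R) (x : 'cV[R]_n) : \bar R := ((fsum f A x)%:E + phi x)%E.
Definition psistar f A (phi : 'cV[R]_n -> \bar R) : \bar R := ereal_inf (range (psi f A phi)).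
Definition Fnat A g (phi : 'cV[R]_n -> \bar R) (x : 'cV[R]_n) : 'cV[R]_n :=
  x - prox 1 phi (x - gradf A g x).
Definition Lbar A (Lc : 'I_N -> R) : R := \big[Num.max/0]_(i < N) (Lc i * opnorm (A i) ^+ 2).

Section Batch.
Context {b : nat}.
Definition dvec (S : b.-tuple 'I_N) := forall j : 'I_b, 'cV[R]_(md (tnth S j)).
Definition gradfS A g (S : b.-tuple 'I_N) (x : 'cV[R]_n) : 'cV[R]_n :=
  b%:R^-1 *: \sum_(j < b) (A (tnth S j))^T *m g (tnth S j) (A (tnth S j) *m x).
Definition AStxi A (S : b.-tuple 'I_N) (xi : dvec S) : 'cV[R]_n :=
  b%:R^-1 *: \sum_(j < b) (A (tnth S j))^T *m xi j.
Definition Vnorm A (gs : forall i : 'I_N, 'cV[R]_(md i) -> 'cV[R]_(md i))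
    (phi : 'cV[R]_n -> \bar R) (S : b.-tuple 'I_N) (alpha : R) (x v : 'cV[R]_n) (xi : dvec S) : R :=
  Num.sqrt (\sum_(j < b)
    vnorm (gs (tnth S j) (xi j)
           - A (tnth S j) *m prox alpha phi (x - alpha *: AStxi A xi + v)) ^+ 2).

(* one inner step of SNSPP with gamma_i = 0 (so M_S = 0):
   xt = tilde x^s, xk = x^{s,k}, e = eps_k^s, xnext = x^{s,k+1} *)
Definition snspp_step A g f gs (phi : 'cV[R]_n -> \bar R) (S : b.-tuple 'I_N) (alpha : R)
    (xt xk : 'cV[R]_n) (e : R) (xnext : 'cV[R]_n) : Prop :=
  let vhat := alpha *: (gradf A g xt - gradfS A g S xt) in
  exists xi : dvec S,
    [/\ forall j, Ddom (f (tnth S j)) (xi j),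
        Vnorm A gs phi alpha xk (- vhat) xi <= e &
        xnext = prox alpha phi (xk - alpha *: AStxi A xi - vhat)].

(* sample paths: omega s k = S_k^s *)
Definition samples := nat -> nat -> b.-tuple 'I_N.

(* x : samples -> nat -> nat -> 'cV_n, x omega s k = x^{s,k} (so tilde x^s = x omega s 0)
   is a possible run of SNSPP (S = oo, Option II, constant alpha and b, inner length m) *)
Definition snspp_run A g f gs (phi : 'cV[R]_n -> \bar R) (alpha : R) (m : nat)
    (x0 : 'cV[R]_n) (eps : samples -> nat -> nat -> R)
    (x : samples -> nat -> nat -> 'cV[R]_n) : Prop :=
  [/\
      forall (om om' : samples) s k,
        (forall s' k', ((s' < s) || ((s' == s) && (k' < k)))%N -> om s' k' = om' s' k') ->
        x om s k = x om' s k,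
      forall om, x om 0%N 0%N = x0,
      forall om s, x om s.+1 0%N = m%:R^-1 *: \sum_(k < m) x om s k.+1 &
      forall om s k, (k < m)%N ->
        snspp_step A g f gs phi (om s k) alpha (x om s 0%N) (x om s k) (eps om s k) (x om s k.+1)].

Definition ext_samples (m T : nat) (d : b.-tuple 'I_N)
    (p : {ffun 'I_T * 'I_m -> b.-tuple 'I_N}) : samples :=
  fun s k => match (insub s : option 'I_T), (insub k : option 'I_m) with
             | Some i, Some j => p (i, j)
             | _, _ => d end.
(* expectation of a quantity depending only on the draws of epochs < T:
   the draws are i.i.d. uniform b-tuples, so this is a finite average *)
Definition Expect (m T : nat) (d : b.-tuple 'I_N) (G : samples -> \bar R) : \bar R :=
  ((#|{ffun 'I_T * 'I_m -> b.-tuple 'I_N}|%:R)^-1%:E *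
     \sum_(p : {ffun 'I_T * 'I_m -> b.-tuple 'I_N}) G (ext_samples d p))%E.
End Batch.
End Problem.

Definition deftuple (N b : nat) (hN : (0 < N)%N) : b.-tuple 'I_N :=
  [tuple of nseq b (Ordinal hN)].

(* Main.v *)
(** For convex [f_i] the equation [grad f_i^*(xi) = y] inverts to [xi = grad f_i(y)],
so an inexact zero of [V] makes [x^{k+1}] an implicit proximal step whose gradient
is the variance-reduced one, [grad f_S(x^{k+1}) - grad f_S(x~) + grad f(x~)], up to
an error bounded by the tolerance.  Comparing this
step with the one linearised at [x^k] through the three-point identity of the
convex function [f_S] leaves a noise that is centred given the past, plus its
correlation with [x^{k+1} - x^k].  The latter is absorbed by Young's inequality
and the step-size bound, its variance being at most
[4 Lbar / b] times the sum of the two optimality gaps, by cocoercivity.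
Strong convexity turns the tolerance [delta |F_nat(x~)|] and the initial distance
into gaps, and summation over the epoch with Jensen's inequality concludes. *)

Require Import Defs.
From HB Require Import structures.
From mathcomp Require Import all_boot all_order all_algebra.
From mathcomp Require Import all_classical all_reals all_analysis.
From mathcomp Require Import ring lra.
Import Order.TTheory GRing.Theory Num.Theory.
Local Open Scope ring_scope.

(** * Euclidean geometry of column vectors *)

Section Euclidean.
Context {R : realType} {p : nat}.
Implicit Types (u v w : 'cV[R]_p) (a : R).

Lemma dotvC u v : dotv u v = dotv v u.
Proof. by apply: eq_bigr => i _; rewrite mulrC. Qed.

Lemma dotvDl u v w : dotv (u + v) w = dotv u w + dotv v w.
Proof. by rewrite -big_split; apply: eq_bigr => i _; rewrite mxE mulrDl. Qed.

Lemma dotvDr u v w : dotv w (u + v) = dotv w u + dotv w v.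
Proof. by rewrite dotvC dotvDl !(dotvC w). Qed.

Lemma dotvZl a u v : dotv (a *: u) v = a * dotv u v.
Proof. by rewrite mulr_sumr; apply: eq_bigr => i _; rewrite mxE mulrA. Qed.

Lemma dotvZr a u v : dotv u (a *: v) = a * dotv u v.
Proof. by rewrite dotvC dotvZl dotvC. Qed.

Lemma dotvNl u v : dotv (- u) v = - dotv u v.
Proof. by rewrite -scaleN1r dotvZl mulN1r. Qed.

Lemma dotvNr u v : dotv u (- v) = - dotv u v.
Proof. by rewrite dotvC dotvNl dotvC. Qed.

Lemma dotv0l v : dotv 0 v = 0.
Proof. by rewrite -(scale0r v) dotvZl mul0r. Qed.

Lemma dotv_suml (I : finType) (F : I -> 'cV[R]_p) v :
  dotv (\sum_i F i) v = \sum_i dotv (F i) v.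
Proof.
by apply: (big_morph (fun u => dotv u v)) => [u w|]; rewrite (dotvDl, dotv0l).
Qed.

Lemma dotv_sumr (I : finType) (F : I -> 'cV[R]_p) v :
  dotv v (\sum_i F i) = \sum_i dotv v (F i).
Proof. by rewrite dotvC dotv_suml; apply: eq_bigr => i _; rewrite dotvC. Qed.

Lemma dotvv_ge0 v : 0 <= dotv v v.
Proof. by apply: sumr_ge0 => i _; rewrite -expr2 sqr_ge0. Qed.

Lemma vnorm_ge0 v : 0 <= vnorm v.
Proof. exact: sqrtr_ge0. Qed.

Lemma vnorm_sqr v : vnorm v ^+ 2 = dotv v v.
Proof. by rewrite sqr_sqrtr // dotvv_ge0. Qed.

Lemma vnormN v : vnorm (- v) = vnorm v.
Proof. by rewrite /vnorm dotvNl dotvNr opprK. Qed.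

Lemma vnormB u v : vnorm (u - v) = vnorm (v - u).
Proof. by rewrite -vnormN opprB. Qed.

Lemma vnormZ a v : vnorm (a *: v) = `|a| * vnorm v.
Proof. by rewrite /vnorm dotvZl dotvZr mulrA -expr2 sqrtrM ?sqr_ge0// sqrtr_sqr. Qed.

Lemma vnorm0 : vnorm (0 : 'cV[R]_p) = 0.
Proof. by rewrite /vnorm dotv0l sqrtr0. Qed.

Lemma coord_le_vnorm v i : `|v i 0| <= vnorm v.
Proof.
rewrite -sqrtr_sqr ler_sqrt ?dotvv_ge0// /dotv (bigD1 i)//= -expr2 lerDl.
by apply: sumr_ge0 => j _; rewrite -expr2 sqr_ge0.
Qed.

Lemma vnorm_eq0 v : vnorm v = 0 -> v = 0.
Proof.
move=> v0; apply/matrixP => i j; rewrite ord1 mxE; apply/eqP.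
by rewrite -normr_le0 -v0 coord_le_vnorm.
Qed.

Lemma cauchy_schwarz u v : dotv u v <= vnorm u * vnorm v.
Proof.
have [v0|v0] := eqVneq (vnorm v) 0.
  by rewrite (vnorm_eq0 v v0) dotvC dotv0l vnorm0 mulr0.
have [u0|u0] := eqVneq (vnorm u) 0.
  by rewrite (vnorm_eq0 u u0) dotv0l vnorm0 mul0r.
have up : 0 < vnorm u by rewrite lt_def u0 vnorm_ge0.
have vp : 0 < vnorm v by rewrite lt_def v0 vnorm_ge0.
have := dotvv_ge0 (vnorm v *: u - vnorm u *: v).
rewrite !(dotvDl, dotvDr, dotvNl, dotvNr, dotvZl, dotvZr) -!vnorm_sqr (dotvC v u).
have uvp := mulr_gt0 up vp => h.
rewrite -(ler_pM2l uvp); move: h.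
lra.
Qed.

Lemma dotv_ge u v : - (vnorm u * vnorm v) <= dotv u v.
Proof. by rewrite lerNl -dotvNl -(vnormN u) cauchy_schwarz. Qed.

Lemma vnormD u v : vnorm (u + v) <= vnorm u + vnorm v.
Proof.
rewrite -(@ler_pXn2r _ 2)// ?nnegrE ?addr_ge0 ?vnorm_ge0// vnorm_sqr.
rewrite !(dotvDl, dotvDr) -!vnorm_sqr (dotvC v u).
have := cauchy_schwarz u v; nra.
Qed.

Lemma vnorm_sum (I : finType) (F : I -> 'cV[R]_p) :
  vnorm (\sum_i F i) <= \sum_i vnorm (F i).
Proof.
apply: (big_ind2 (fun u a => vnorm u <= a)) => // [|u1 a1 u2 a2 h1 h2].
  by rewrite vnorm0.
by rewrite (le_trans (vnormD _ _))// lerD.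
Qed.

Lemma vnorm_le_coord v a : 0 <= a -> (forall i, `|v i 0| <= a) -> vnorm v <= p%:R * a.
Proof.
move=> a0 va.
have -> : v = \sum_(i < p) v i 0 *: delta_mx i 0.
  rewrite {1}[v]matrix_sum_delta; apply: eq_bigr => i _.
  by rewrite big_ord1.
apply: (le_trans (vnorm_sum _ _)).
rewrite mulr_natl -[X in _ *+ X](card_ord p) -sumr_const; apply: ler_sum => i _.
rewrite vnormZ -[leRHS]mulr1 ler_pM ?vnorm_ge0// /vnorm.
suff -> : dotv (delta_mx i 0 : 'cV[R]_p) (delta_mx i 0) = 1 by rewrite sqrtr1.
rewrite /dotv (bigD1 i)//= mxE !eqxx mulr1 big1 ?addr0// => j ji.
by rewrite mxE (negPf ji) mul0r.
Qed.

Lemma young (t : R) u v : 0 < t ->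
  dotv u v <= t / 2 * dotv v v + (2 * t)^-1 * dotv u u.
Proof.
move=> t0; have := mulr_ge0 (ltW t0) (dotvv_ge0 (t^-1 *: u - v)).
have -> : t * dotv (t^-1 *: u - v) (t^-1 *: u - v) =
    2 * (t / 2 * dotv v v + (2 * t)^-1 * dotv u u - dotv u v).
  rewrite !(dotvDl, dotvDr, dotvNl, dotvNr, dotvZl, dotvZr) (dotvC v u).
  by field; rewrite gt_eqF.
lra.
Qed.

End Euclidean.

Definition dotvE := (@dotvDl, @dotvDr, @dotvNl, @dotvNr, @dotvZl, @dotvZr).

(** * Operator norm and adjoint *)

Section OperatorNorm.
Context {R : realType} {p q : nat}.
Implicit Types (M : 'M[R]_(p, q)).

Lemma dotv_mulmx M x y : dotv (M *m x) y = dotv x (M^T *m y).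
Proof.
rewrite /dotv; under eq_bigr => i _ do rewrite mxE big_distrl/=.
rewrite exchange_big/=; apply: eq_bigr => j _; rewrite mxE big_distrr/=.
by apply: eq_bigr => i _; rewrite mxE mulrCA mulrA.
Qed.

(** [sup] carries information only on a non-empty bounded set. Cauchy-Schwarz on each row bounds the
    coordinates of [M *m x] over the unit ball. *)
Lemma opnorm_has_sup M :
  has_sup [set vnorm (M *m x) | x in [set x : 'cV[R]_q | vnorm x <= 1]].
Proof.
split; first by exists (vnorm (M *m 0)), 0; rewrite //= vnorm0.
exists (p%:R * \sum_(i < p) vnorm (row i M)^T) => _ [x /= x1 <-].
apply: vnorm_le_coord => [|i]; first by apply: sumr_ge0 => i _; exact: vnorm_ge0.
have -> : (M *m x) i 0 = dotv (row i M)^T x.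
  by rewrite mxE; apply: eq_bigr => j _; rewrite !mxE.
apply: (@le_trans _ _ (vnorm (row i M)^T)); last first.
  by rewrite (bigD1 i)//= lerDl; apply: sumr_ge0 => j _; exact: vnorm_ge0.
have h : vnorm (row i M)^T * vnorm x <= vnorm (row i M)^T.
  by rewrite -[leRHS]mulr1 ler_wpM2l ?vnorm_ge0.
rewrite ler_norml (le_trans _ (dotv_ge _ _)) ?lerN2//=.
exact: le_trans (cauchy_schwarz _ _) h.
Qed.

Lemma opnorm_ge0 M : 0 <= opnorm M.
Proof.
apply: (@le_trans _ _ (vnorm (M *m 0))); first exact: vnorm_ge0.
apply: ub_le_sup; first by case: (opnorm_has_sup M).
by exists 0; rewrite //= vnorm0.
Qed.

Lemma vnorm_mulmx M x : vnorm (M *m x) <= opnorm M * vnorm x.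
Proof.
have [x0|x0] := eqVneq (vnorm x) 0.
  by rewrite (vnorm_eq0 x x0) mulmx0 !vnorm0 mulr0.
have xp : 0 < vnorm x by rewrite lt_def x0 vnorm_ge0.
have : vnorm (M *m ((vnorm x)^-1 *: x)) <= opnorm M.
  apply: ub_le_sup; first by case: (opnorm_has_sup M).
  by exists ((vnorm x)^-1 *: x); rewrite //= vnormZ ger0_norm ?invr_ge0 ?vnorm_ge0// mulVf.
rewrite -scalemxAr vnormZ ger0_norm ?invr_ge0 ?vnorm_ge0//.
by rewrite mulrC ler_pdivrMr.
Qed.

(** Write the square of the left side as [dotv y (M *m (M^T *m y))], apply Cauchy-Schwarz and
    divide. *)
Lemma vnorm_trmulmx M y : vnorm (M^T *m y) <= opnorm M * vnorm y.
Proof.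
have [y0|y0] := eqVneq (vnorm (M^T *m y)) 0.
  by rewrite y0 mulr_ge0 ?opnorm_ge0 ?vnorm_ge0.
have yp : 0 < vnorm (M^T *m y) by rewrite lt_def y0 vnorm_ge0.
rewrite -(ler_pM2l yp) -expr2 vnorm_sqr -dotv_mulmx.
apply: (le_trans (cauchy_schwarz _ _)).
by rewrite mulrA ler_wpM2r ?vnorm_ge0// mulrC vnorm_mulmx.
Qed.

End OperatorNorm.

(** * Smooth convex functions and minimisers *)

(** Replaces the limit [t -> 0] in all first-order arguments below. If [a > 0], the choice
    [t = a / (a + |B| + 1)] is contradictory. *)
Lemma le0_of_small {R : realType} (a B : R) :
  (forall t : R, 0 < t <= 1 -> a <= t * B) -> a <= 0.
Proof.
move=> h; rewrite leNgt; apply/negP => a0.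
have B0 : 0 <= `|B| by [].
have s0 : 0 < a + `|B| + 1 by lra.
have := h (a / (a + `|B| + 1)).
rewrite divr_gt0//= ler_pdivrMr// mul1r => /(_ _)/wrap[]; first by lra.
rewrite mulrAC ler_pdivlMr// => ?.
have := ler_norm B; nra.
Qed.

Lemma ex_small_scale {R : realType} (d r : R) : 0 < d -> 0 <= r ->
  exists2 t : R, 0 < t <= 1 & t * r < d.
Proof.
move=> d0 r0; have s0 : 0 < d + r by lra.
exists (d / (d + r)); first by rewrite divr_gt0//= ler_pdivrMr// mul1r; lra.
by rewrite mulrAC ltr_pdivrMr//; nra.
Qed.

Section SmoothConvex.
Context {R : realType} {p : nat}.
Implicit Types (f : 'cV[R]_p -> R) (g : 'cV[R]_p -> 'cV[R]_p).

Definition is_subgrad f g := forall x y, f x + dotv (g x) (y - x) <= f y.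

Lemma convex_subgrad f g : has_grad f g -> convex_fun f -> is_subgrad f g.
Proof.
move=> fg cf x y; rewrite -subr_le0.
apply: (@le0_of_small _ _ (vnorm (y - x))) => e /andP[e0 _].
have [d d0 hd] := fg x e e0.
have [t /andP[t0 t1] td] := ex_small_scale _ _ d0 (vnorm_ge0 (y - x)).
have := hd (t *: (y - x)); rewrite vnormZ gtr0_norm// => /(_ td).
have := cf y x t; rewrite t1 ltW//= => /(_ isT).
have -> : t *: y + (1 - t) *: x = x + t *: (y - x).
  by rewrite scalerBl scale1r scalerBr addrCA.
rewrite dotvZr ler_norml => h1 /andP[h2 _].
rewrite -(ler_pM2l t0); nra.
Qed.

Lemma ex_expr2_inv_lt (t : R) : 0 < t -> exists k : nat, (2 ^+ k)^-1 <= t.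
Proof.
move=> t0; exists (Num.truncn t^-1).+1.
rewrite -[leRHS]invrK lef_pV2 ?posrE ?invr_gt0 ?exprn_gt0//.
apply/ltW/(lt_le_trans (truncnS_gt _)).
by rewrite -natrX ler_nat ltnW// ltn_expl.
Qed.

(* Iterated halving of the segment turns the crude constant L into L/2. *)
Lemma descent f g L x h : is_subgrad f g -> lipK g L ->
  f (x + h) <= f x + dotv (g x) h + L / 2 * dotv h h.
Proof.
move=> fg gL.
have mono y k : dotv (g (y + k)) k - dotv (g y) k <= L * dotv k k.
  rewrite -dotvNl -dotvDl (le_trans (cauchy_schwarz _ _))//.
  rewrite -vnorm_sqr expr2 mulrA ler_wpM2r ?vnorm_ge0//.
  by rewrite (le_trans (gL _ _))// addrAC subrr add0r.
(* Splitting [v] into two halves and using [mono] between them gives the factors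
   [c_(k+1) = c_k / 2 + 1 / 4] with [c_0 = 1], which decrease to [1 / 2]. *)
have H k : forall y v,
    f (y + v) <= f y + dotv (g y) v + (1 + (2 ^+ k)^-1) / 2 * (L * dotv v v).
  elim: k => [|k IH] y v.
    have := fg (y + v) y; have := mono y v.
    rewrite opprD addrA subrr add0r dotvNr expr0 invr1; lra.
  have e : y + v = (y + 2^-1 *: v) + 2^-1 *: v.
    by rewrite -addrA -scalerDl (_ : 2^-1 + 2^-1 = 1) ?scale1r//; lra.
  have := IH (y + 2^-1 *: v) (2^-1 *: v); rewrite -e.
  have := IH y (2^-1 *: v); have := mono y (2^-1 *: v).
  rewrite !(dotvZl, dotvZr) exprS invfM; lra.
rewrite -subr_le0; apply: (@le0_of_small _ _ (`|L * dotv h h| / 2)) => t /andP[t0 _].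
have [k kt] := ex_expr2_inv_lt t t0; have := H k x h.
have i0 : 0 <= (2 ^+ k)^-1 :> R by rewrite invr_ge0 exprn_ge0.
have := ler_norm (L * dotv h h); have := normr_ge0 (L * dotv h h).
set n := `| _ |; set l := L * _ => n0 ln hh.
have : (2 ^+ k)^-1 * l <= t * n by rewrite (@le_trans _ _ ((2 ^+ k)^-1 * n)) ?ler_wpM2l ?ler_wpM2r.
rewrite (_ : L / 2 * _ = l / 2); last by rewrite /l mulrAC.
lra.
Qed.

(** Both bounds are taken at the gradient step [x - G / L]: the descent inequality from [x] above,
    the subgradient inequality at [y] below. *)
Lemma cocoercive f g L x y : 0 <= L -> is_subgrad f g -> lipK g L ->
  dotv (g x - g y) (g x - g y) <= 2 * L * (f x - f y - dotv (g y) (x - y)).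
Proof.
move=> L0 fg gL; have [L00|Ln0] := eqVneq L 0.
  have := gL x y; rewrite L00 mul0r => h.
  by rewrite -vnorm_sqr (_ : vnorm _ = 0) ?expr0n/= ?mulr0 ?mul0r//; apply/eqP; rewrite eq_le h vnorm_ge0.
have Lp : 0 < L by rewrite lt_def Ln0.
have LV : L * L^-1 = 1 by rewrite divff.
move GE : (g x - g y) => G.
have h1 := descent f g L x (- (L^-1 *: G)) fg gL.
have h2 := fg y (x - L^-1 *: G).
have h3 : dotv (g x) G - dotv (g y) G = dotv G G by rewrite -{3}GE dotvDl dotvNl.
move: h1 h2; rewrite !(dotvDr, dotvNr, dotvNl, dotvZl, dotvZr) => h1 h2.
have h4 : L * (f y + (dotv (g y) x - L^-1 * dotv (g y) G - dotv (g y) y)) <=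
  L * (f x - L^-1 * dotv (g x) G + L / 2 * (L^-1 * (L^-1 * dotv G G))).
  by rewrite ler_pM2l//; lra.
have h5 : L * (L^-1 * dotv (g y) G) = dotv (g y) G by rewrite mulrA LV mul1r.
have h6 : L * (L^-1 * dotv (g x) G) = dotv (g x) G by rewrite mulrA LV mul1r.
have h7 : L * (L / 2 * (L^-1 * (L^-1 * dotv G G))) = dotv G G / 2 by field.
lra.
Qed.

(* Near-maximisers of [<xi, z> - f z] converge to the gradient [y] of the
   conjugate at [xi], so [y] itself attains the supremum; no biconjugation is needed. *)
Lemma grad_conj_inv f g L G xi : is_subgrad f g -> lipK g L ->
  ess_diff (fconj f) G (Ddom f) -> Ddom f xi -> g (G xi) = xi.
Proof.
move=> fg gL [_ diff _] Dxi; have [fin df] := diff xi Dxi.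
set y := G xi in df *.
have UB xi' z : (fconj f xi' < +oo)%E -> dotv xi' z - f z <= fine (fconj f xi').
  move=> lt; have le : ((dotv xi' z - f z)%:E <= fconj f xi')%E.
    by apply: ereal_sup_ubound; exists z.
  by rewrite -lee_fin fineK// fin_real// lt andbT (lt_le_trans (ltNyr _) le).
have fin' : (fconj f xi < +oo)%E by rewrite ltey_eq fin.
set c := fine (fconj f xi) in df.
have near (e : R) : 0 < e -> exists2 z, c - e < dotv xi z - f z & vnorm (z - y) <= e.
  move=> e0.
  have [|d d0 hd] := df (e / 4); first by lra.
  have [r r0 hr] := Dxi.
  pose d' := Num.min d r.
  have d'0 : 0 < d' by rewrite lt_min d0.
  pose ep := Num.min e (e * d' / 8).
  have ep0 : 0 < ep by rewrite lt_min e0 !mulr_gt0.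
  have : ((c - ep)%:E < fconj f xi)%E by rewrite -(fineK fin) lte_fin -/c; lra.
  move=> /ereal_sup_gt[_ [z _ <-]]; rewrite lte_fin => zc.
  have epe : ep <= e by rewrite ge_min lexx.
  have epd : ep <= e * d' / 8 by rewrite ge_min lexx orbT.
  exists z; first by lra.
  have [w0|wn0] := eqVneq (vnorm (z - y)) 0; first by rewrite w0 ltW.
  have wp : 0 < vnorm (z - y) by rewrite lt_def wn0 vnorm_ge0.
  (* Perturbing [xi] along [z - y] measures the distance to [y]: near-maximality of [z] costs
     [ep <= e * d' / 8] and the differentiability error at most as much, so [|z - y| <= e / 2]. The
     bound [d' <= r] keeps [xi + v] where the conjugate is finite. *)
  pose v := (d' / 2 / vnorm (z - y)) *: (z - y).
  have nv : vnorm v = d' / 2.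
    by rewrite vnormZ gtr0_norm ?divr_gt0// divfK.
  have vw : dotv v (z - y) = d' / 2 * vnorm (z - y).
    by rewrite dotvZl -vnorm_sqr expr2 mulrA divfK.
  have d'd : d' <= d by rewrite ge_min lexx.
  have d'r : d' <= r by rewrite ge_min lexx orbT.
  have := hd v; rewrite nv => /(_ _)/wrap[]; first by lra.
  have /(UB _ z) : (fconj f (xi + v) < +oo)%E.
    by apply: hr; rewrite addrAC subrr add0r nv; lra.
  rewrite dotvDl ler_norml => h1 /andP[_ h2].
  move: vw; rewrite dotvDr dotvNr (dotvC v y) => vw.
  have : d' / 2 * vnorm (z - y) <= d' / 2 * (e / 2) by lra.
  rewrite ler_pM2l; lra.
have key : c <= dotv xi y - f y.
  rewrite -subr_le0; apply: (@le0_of_small _ _ (vnorm (xi - g y) + 1)) => e /andP[e0 _].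
  have [z zc zy] := near e e0.
  have := fg y z; have := cauchy_schwarz (xi - g y) (z - y).
  have : vnorm (xi - g y) * vnorm (z - y) <= vnorm (xi - g y) * e.
    by rewrite ler_wpM2l ?vnorm_ge0.
  rewrite !dotvE; lra.
have sub z : f y + dotv xi (z - y) <= f z.
  by have := UB xi z fin'; rewrite dotvDr dotvNr -/c; lra.
(* By [sub], [xi] is a subgradient of [f] at [y]. Against the descent inequality along
   [h = xi - g y] this yields [|h|^2 <= t * (L / 2) * |h|^2] for small [t]. *)
suff : vnorm (xi - g y) = 0 by move=> /vnorm_eq0/eqP; rewrite subr_eq0 => /eqP.
apply/eqP; rewrite -sqrf_eq0 eq_le sqr_ge0 andbT vnorm_sqr.
move hE : (xi - g y) => h.
apply: (@le0_of_small _ _ (L / 2 * dotv h h)) => t /andP[t0 _].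
have := sub (y + t *: h); have := descent f g L y (t *: h) fg gL.
rewrite [y + _ - y]addrC addKr !(dotvZl, dotvZr) => h1 h2.
have h3 : dotv h h = dotv xi h - dotv (g y) h by rewrite -{1}hE dotvDl dotvNl.
have := congr1 ( *%R t) h3; rewrite mulrBr -(ler_pM2l t0); lra.
Qed.

End SmoothConvex.

(** * Existence and growth for strongly convex functions *)

Section Minimisers.
Context {R : realType} {p : nat}.
Implicit Types (D : set 'cV[R]_p) (q : 'cV[R]_p -> R).

(** An extended-valued function is split into its domain [D] and a real function [q], so that
    arithmetic stays in [R]. Plain convexity is the case [mu = 0]. *)
Definition sconvex_on (mu : R) D q := forall x y (t : R), D x -> D y -> 0 <= t <= 1 ->
  D (t *: x + (1 - t) *: y) /\
  q (t *: x + (1 - t) *: y) <= t * q x + (1 - t) * q y - mu / 2 * t * (1 - t) * dotv (x - y) (x - y).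

(** Outside [D] the value counts as [+oo], so every [t] qualifies at such a point. *)
Definition lsc_on D q := forall x (t : R), (D x -> t < q x) ->
  exists2 d : R, 0 < d & forall y, vnorm (y - x) < d -> D y -> t < q y.

Lemma lsc_onD D q (h : 'cV[R]_p -> R) (v : 'cV[R]_p -> 'cV[R]_p) :
  lsc_on D q -> is_subgrad h v -> lsc_on D (fun x => q x + h x).
Proof.
move=> lq hv x t xt.
have [Dx|nDx] := pselect (D x).
- pose e := (q x + h x - t) / 2.
  have e0 : 0 < e by have := xt Dx; rewrite /e; lra.
  have [_|d d0 hd] := lq x (q x - e); first by lra.
  have [s /andP[s0 _] sd] := ex_small_scale _ _ e0 (vnorm_ge0 (v x)).
  exists (Num.min d s); first by rewrite lt_min d0.
  move=> y; rewrite lt_min => /andP[yd ys] Dy.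
  have := hd y yd Dy; have := hv x y; have := dotv_ge (v x) (y - x).
  have : vnorm (v x) * vnorm (y - x) <= vnorm (v x) * s by rewrite ler_wpM2l ?vnorm_ge0 ?ltW.
  move: e0; rewrite /e in sd *; lra.
- have [//|d d0 hd] := lq x (t - h x + 1).
  have [s /andP[s0 _] sd] := ex_small_scale _ _ (@ltr01 R) (vnorm_ge0 (v x)).
  exists (Num.min d s); first by rewrite lt_min d0.
  move=> y; rewrite lt_min => /andP[yd ys] Dy.
  have := hd y yd Dy; have := hv x y; have := dotv_ge (v x) (y - x).
  have : vnorm (v x) * vnorm (y - x) <= vnorm (v x) * s by rewrite ler_wpM2l ?vnorm_ge0 ?ltW.
  lra.
Qed.

(** The direct method: strong convexity at midpoints makes near-minimisers a Cauchy family, and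
    lower semicontinuity at the limit gives both membership in [D] and minimality. *)
Lemma sconvex_min (mu c : R) D q : 0 < mu -> (exists x, D x) ->
  sconvex_on mu D q -> lsc_on D q -> (forall x, D x -> c <= q x) ->
  exists2 x, D x & forall y, D y -> q x <= q y.
Proof.
move=> mu0 [x0 Dx0] sc lq qc.
have hi : has_inf [set q x | x in D].
  split; first by exists (q x0), x0.
  by exists c => _ [x Dx <-]; exact: qc.
set i := inf [set q x | x in D].
have iq x : D x -> i <= q x by move=> Dx; apply: ge_inf; [case: hi|exists x].
(* The tolerance [e ^+ 2] in value makes distances linear in [e]. The implication makes the choice
   total over [R]. *)
have ex (e : R) : exists x, 0 < e -> D x /\ q x < i + e ^+ 2.
  have [e0|] := boolP (0 < e); last by exists x0.
  have [_ [x Dx <-] xe] := inf_adherent (exprn_gt0 2 e0) hi.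
  by exists x => _; split.
have [u hu] := choice ex.
pose K := Num.sqrt (8 / mu).
have K0 : 0 <= K by rewrite sqrtr_ge0.
have Ksq : K ^+ 2 = 8 / mu by rewrite sqr_sqrtr// divr_ge0// ltW.
have cau e e' : 0 < e -> 0 < e' -> vnorm (u e - u e') <= K * (e + e').
  move=> e0 e'0; have [De qe] := hu e e0; have [De' qe'] := hu e' e'0.
  have [|Dm] := sc (u e) (u e') 2^-1 De De'; first by lra.
  have := iq _ Dm => h1 h2.
  have h3 : mu * dotv (u e - u e') (u e - u e') <= 8 * (e ^+ 2 + e' ^+ 2) by nra.
  have s0 : 0 <= K * (e + e') by rewrite mulr_ge0// addr_ge0// ltW.
  rewrite -(@ler_pXn2r _ 2)// ?nnegrE ?vnorm_ge0//.
  rewrite vnorm_sqr exprMn Ksq -(ler_pM2l mu0) (le_trans h3)//.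
  rewrite (_ : mu * (8 / mu * _) = 8 * (e + e') ^+ 2); last by field; rewrite gt_eqF.
  nra.
(* Completeness by nested intervals: each coordinate of the limit is the supremum of the lower ends
   [u e j 0 - K * e]. *)
pose a j := sup [set u e j 0 - K * e | e in [set e : R | 0 < e]].
have cl j e : 0 < e -> `|u e j 0 - a j| <= K * e.
  move=> e0.
  have cj e1 e2 : 0 < e1 -> 0 < e2 -> u e1 j 0 - K * e1 <= u e2 j 0 + K * e2.
    move=> e10 e20; have := le_trans (coord_le_vnorm (u e1 - u e2) j) (cau _ _ e10 e20).
    by rewrite !mxE ler_norml => /andP[_]; lra.
  have hs : has_sup [set u e j 0 - K * e | e in [set e : R | 0 < e]].
    split; first by exists (u 1 j 0 - K * 1), 1 => //=.
    by exists (u e j 0 + K * e) => _ [e1 /= e10 <-]; exact: cj.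
  have : u e j 0 - K * e <= a j.
    by apply: ub_le_sup; [case: hs | exists e].
  have : a j <= u e j 0 + K * e.
    by apply: ge_sup; [case: hs | move=> _ [e1 /= e10 <-]; exact: cj].
  by rewrite ler_norml; lra.
pose x := \col_j a j.
have ux e : 0 < e -> vnorm (u e - x) <= p%:R * (K * e).
  move=> e0; apply: vnorm_le_coord => [|j]; first by rewrite mulr_ge0// ltW.
  by rewrite !mxE cl.
have absurd t : i < t -> (D x -> t < q x) -> False.
  move=> it /lq[d d0 hd].
  have [s /andP[s0 s1] sd] := ex_small_scale _ _ d0 (mulr_ge0 (ler0n R p) K0).
  have ti : 0 < t - i by rewrite subr_gt0.
  have [r /andP[r0 r1] rt] := ex_small_scale _ _ ti (@ler01 R).
  pose e := Num.min s r.
  have e0 : 0 < e by rewrite lt_min s0.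
  have es : e <= s by rewrite ge_min lexx.
  have er : e <= r by rewrite ge_min lexx orbT.
  have [De qe] := hu e e0.
  have := hd (u e); rewrite (le_lt_trans (ux e e0)) => [/(_ isT De)|]; first by nra.
  have : p%:R * K * e <= p%:R * K * s by rewrite ler_wpM2l// mulr_ge0.
  by lra.
have Dx : D x by apply: contrapT => nDx; apply: (absurd (i + 1)) => //; lra.
exists x => // y Dy; rewrite leNgt; apply/negP => yx.
have iy := iq y Dy.
by apply: (absurd ((i + q x) / 2)) => //; lra.
Qed.

(** Compare [x] with a point of the segment towards [y], divide by [t] and let [t] vanish. It serves
    both for [psi] and for the objective of the prox. *)
Lemma sconvex_growth (mu : R) D q x y : sconvex_on mu D q -> D x -> D y ->
  (forall z, D z -> q x <= q z) -> q x + mu / 2 * dotv (y - x) (y - x) <= q y.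
Proof.
move=> sc Dx Dy xmin; rewrite -subr_le0.
apply: (@le0_of_small _ _ (mu / 2 * dotv (y - x) (y - x))) => t /andP[t0 t1].
have [|Dz qz] := sc y x t Dy Dx; first by rewrite t1 ltW.
by have xz := xmin _ Dz; rewrite -(ler_pM2l t0); lra.
Qed.

End Minimisers.

(** * Averages over i.i.d. batches *)

Section Averages.
Context {R : realType}.

(* [(w, t) |-> (upd w t, coord w)] is an involution: replacing a uniform
   coordinate by an independent copy does not change the joint law. *)
Lemma sum_resample (W T : finType) (coord : W -> T) (upd : W -> T -> W)
    (H : W -> T -> R) :
  (forall w t, coord (upd w t) = t) ->
  (forall w t, upd (upd w t) (coord w) = w) ->
  (forall w t t', H (upd w t') t = H w t) ->
  #|T|%:R * \sum_w H w (coord w) = \sum_w \sum_t H w t.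
Proof.
move=> updE updK indep.
rewrite [RHS]pair_bigA/= (reindex (fun x => (upd x.1 x.2, coord x.1)))/=; last first.
  by exists (fun x => (upd x.1 x.2, coord x.1)) => -[w t] _ /=; rewrite updE updK.
rewrite -(pair_bigA _ (fun w t => H (upd w t) (coord w)))/= mulr_sumr.
apply: eq_bigr => w _; under eq_bigr => t _ do rewrite indep.
by rewrite sumr_const mulr_natl.
Qed.

(** The form used along an epoch: with the past held fixed, the current draw may be averaged
    separately. *)
Lemma sum_ffun_resample (I T : finType) (i : I) (H : {ffun I -> T} -> T -> R) :
  (forall (w w' : {ffun I -> T}) t, (forall j, j != i -> w j = w' j) -> H w t = H w' t) ->
  #|T|%:R * \sum_w H w (w i) = \sum_w \sum_t H w t.
Proof.
move=> indep; apply: (@sum_resample _ _ (fun w : {ffun I -> T} => w i)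
  (fun w t => [ffun j => if j == i then t else w j] : {ffun I -> T})) => [w t|w t|w t t'].
- by rewrite ffunE eqxx.
- by apply/ffunP => j; rewrite !ffunE; case: eqP => // ->.
- by apply: indep => j /negPf ji; rewrite ffunE ji.
Qed.

Lemma sum_tuple_resample (b : nat) (T : finType) (i : 'I_b) (H : b.-tuple T -> T -> R) :
  (forall (w w' : b.-tuple T) t, (forall j, j != i -> tnth w j = tnth w' j) -> H w t = H w' t) ->
  #|T|%:R * \sum_w H w (tnth w i) = \sum_w \sum_t H w t.
Proof.
move=> indep; apply: (@sum_resample _ _ (fun w => tnth w i)
  (fun w t => [tuple if j == i then t else tnth w j | j < b])) => [w t|w t|w t t'].
- by rewrite tnth_mktuple eqxx.
- by apply/eq_from_tnth => j; rewrite !tnth_mktuple; case: eqP => // ->.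
- by apply: indep => j /negPf ji; rewrite tnth_mktuple ji.
Qed.

Context {N b : nat}.
Context (N_gt0 : (0 < N)%N) (b_gt0 : (0 < b)%N).
Local Notation T := (b.-tuple 'I_N).

Let N_neq0 : N%:R != 0 :> R. Proof. by rewrite pnatr_eq0 -lt0n. Qed.
Let b_neq0 : b%:R != 0 :> R. Proof. by rewrite pnatr_eq0 -lt0n. Qed.

Let meanK (y : R) : b%:R^-1 * (y *+ b) = y.
Proof. by rewrite -(mulr_natl y) (mulKf b_neq0). Qed.

Lemma sum_tnth (F : 'I_N -> R) (j : 'I_b) :
  \sum_(S : T) F (tnth S j) = #|{: T}|%:R * (N%:R^-1 * \sum_i F i).
Proof.
apply: (mulfI N_neq0).
have := @sum_tuple_resample _ _ j (fun _ t => F t) (fun _ _ _ _ => erefl).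
rewrite card_ord => ->.
by rewrite sumr_const -[LHS]mulr_natl [RHS]mulrCA (mulVKf N_neq0).
Qed.

Lemma sum_batch_mean (F : 'I_N -> R) :
  \sum_(S : T) (b%:R^-1 * \sum_j F (tnth S j)) = #|{: T}|%:R * (N%:R^-1 * \sum_i F i).
Proof.
rewrite -mulr_sumr exchange_big/= (eq_bigr _ (fun j _ => sum_tnth F j)).
by rewrite sumr_const card_ord meanK.
Qed.

(** Distinct positions of a batch are independent, so position [j] can be averaged first with
    position [l] fixed. *)
Lemma sum_tnth2 (F : 'I_N -> 'I_N -> R) (j l : 'I_b) : j != l ->
  (forall i, \sum_t F t i = 0) -> \sum_(S : T) F (tnth S j) (tnth S l) = 0.
Proof.
move=> jl F0; apply: (mulfI N_neq0); rewrite mulr0.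
have := @sum_tuple_resample _ _ j (fun S t => F t (tnth S l)); rewrite card_ord => ->.
  by apply: big1 => S _; exact: F0.
by move=> w w' t ww'; rewrite ww' // eq_sym.
Qed.

(** Cross terms vanish by independence and the [b] diagonal terms leave the factor [1 / b]; the
    centred second moment is at most the raw one. *)
Lemma sum_batch_variance (p : nat) (w : 'I_N -> 'cV[R]_p) (e : T -> 'cV[R]_p) :
  (forall S, e S = b%:R^-1 *: (\sum_j w (tnth S j)) - N%:R^-1 *: \sum_i w i) ->
  \sum_S dotv (e S) (e S) <= #|{: T}|%:R * (b%:R^-1 * (N%:R^-1 * \sum_i dotv (w i) (w i))).
Proof.
move=> e_def; pose wm := N%:R^-1 *: \sum_i w i.
have swm : \sum_i w i = N%:R *: wm by rewrite scalerA divff// scale1r.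
have eE S : e S = b%:R^-1 *: \sum_j (w (tnth S j) - wm).
  by rewrite e_def sumrB sumr_const card_ord scalerBr -[wm *+ b]scaler_nat scalerA mulVf// scale1r.
have sum_w0 : \sum_i (w i - wm) = 0.
  by rewrite sumrB sumr_const card_ord -[wm *+ N]scaler_nat swm subrr.
have cross j l : j != l ->
    \sum_(S : T) dotv (w (tnth S j) - wm) (w (tnth S l) - wm) = 0.
  move=> jl; apply: (@sum_tnth2 (fun i k => dotv (w i - wm) (w k - wm))) => // k.
  by rewrite -dotv_suml sum_w0 dotv0l.
have -> : \sum_S dotv (e S) (e S) =
    #|{: T}|%:R * (b%:R^-1 * (N%:R^-1 * \sum_i dotv (w i - wm) (w i - wm))).
  have eeE S : dotv (e S) (e S) = b%:R^-1 * (b%:R^-1 *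
      \sum_j \sum_l dotv (w (tnth S j) - wm) (w (tnth S l) - wm)).
    rewrite eE dotvZl dotvZr dotv_suml; do 2 congr (_ * _).
    by apply: eq_bigr => j _; rewrite dotv_sumr.
  have inner (j : 'I_b) : \sum_(S : T) \sum_l dotv (w (tnth S j) - wm) (w (tnth S l) - wm) =
      #|{: T}|%:R * (N%:R^-1 * \sum_i dotv (w i - wm) (w i - wm)).
    rewrite exchange_big/= (bigD1 j)//= [X in _ + X]big1 => [|l lj]; last first.
      by rewrite cross// eq_sym.
    by rewrite addr0 (sum_tnth (fun i => dotv (w i - wm) (w i - wm))).
  rewrite (eq_bigr _ (fun S _ => eeE S)) -!mulr_sumr exchange_big/=.
  by rewrite (eq_bigr _ (fun j _ => inner j)) sumr_const card_ord meanK mulrCA.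
rewrite ler_wpM2l// ler_wpM2l ?invr_ge0// ler_wpM2l ?invr_ge0//.
have expand i : dotv (w i - wm) (w i - wm) =
    dotv (w i) (w i) - 2 * dotv (w i) wm + dotv wm wm.
  by rewrite !(dotvDl, dotvDr, dotvNl, dotvNr) (dotvC wm (w i)); ring.
rewrite (eq_bigr _ (fun i _ => expand i)) big_split sumrB /= -mulr_sumr.
rewrite -dotv_suml swm dotvZl sumr_const card_ord -[_ *+ N]mulr_natl.
have : 0 <= N%:R * dotv wm wm by rewrite mulr_ge0// dotvv_ge0.
lra.
Qed.

End Averages.

(** * The composite problem *)

Section Problem.
Context {R : realType} {n N : nat} {md : 'I_N -> nat}.
Context (A : forall i : 'I_N, 'M[R]_(md i, n))
  (f : forall i : 'I_N, 'cV[R]_(md i) -> R)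
  (g : forall i : 'I_N, 'cV[R]_(md i) -> 'cV[R]_(md i))
  (phi : 'cV[R]_n -> \bar R).
Context (fg : forall i, is_subgrad (f i) (g i)).

Definition gradi (i : 'I_N) (x : 'cV[R]_n) : 'cV[R]_n := (A i)^T *m g i (A i *m x).
Definition domphi : set 'cV[R]_n := [set x | phi x \is a fin_num].
(** Meaningful only on [domphi], since [fine] sends infinite values to 0. *)
Definition phir (x : 'cV[R]_n) : R := fine (phi x).
Definition psir (x : 'cV[R]_n) : R := phir x + fsum f A x.

Lemma gradi_subgrad i : is_subgrad (fun x => f i (A i *m x)) (gradi i).
Proof.
move=> x y; have := fg i (A i *m x) (A i *m y).
by rewrite -mulmxBr dotvC dotv_mulmx dotvC.
Qed.

Lemma dotv_gradf x z : dotv (gradf A g x) z = N%:R^-1 * \sum_i dotv (gradi i x) z.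
Proof. by rewrite dotvZl dotv_suml. Qed.

Lemma fsum_subgrad : is_subgrad (fsum f A) (gradf A g).
Proof.
move=> x y; rewrite dotv_gradf -mulrDr -big_split/= ler_wpM2l ?invr_ge0//.
by apply: ler_sum => i _; exact: gradi_subgrad.
Qed.

Lemma phirE x : domphi x -> phi x = (phir x)%:E.
Proof. by move=> Dx; rewrite fineK. Qed.

Context (phi_pcc : proper_closed_convex phi).

Lemma phi_out x : ~ domphi x -> phi x = +oo%E.
Proof.
have [[phiN _] _ _] := phi_pcc => nD.
by apply/eqP; move: (phiN x) nD; rewrite /domphi/= fin_numE; case: (phi x) => [r| |]// _ [].
Qed.

Lemma domphi_lt x (r : R) : (phi x <= r%:E)%E -> domphi x /\ phir x <= r.
Proof.
move=> xr; have Dx : domphi x.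
  apply: contrapT => /phi_out xoo; by move: xr; rewrite xoo leye_eq.
by split=> //; rewrite -lee_fin -phirE.
Qed.

Lemma phir_sconvex : sconvex_on 0 domphi phir.
Proof.
have [_ _ phic] := phi_pcc => x y t Dx Dy t01.
have := phic x y t t01; rewrite (phirE _ Dx) (phirE _ Dy) -!EFinM -EFinD.
by rewrite !mul0r subr0; exact: domphi_lt.
Qed.

Lemma phir_lsc : lsc_on domphi phir.
Proof.
have [_ phil _] := phi_pcc => x t xt.
have [|d d0 hd] := phil x t.
  have [Dx|/phi_out ->] := pselect (domphi x); last exact: ltry.
  by rewrite phirE// lte_fin xt.
by exists d => // y yd Dy; have := hd y yd; rewrite phirE// lte_fin.
Qed.

Lemma psiE x : domphi x -> psi f A phi x = (psir x)%:E.
Proof. by move=> Dx; rewrite /psi phirE// -EFinD addrC. Qed.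

Lemma psi_out x : ~ domphi x -> psi f A phi x = +oo%E.
Proof. by move=> /phi_out xoo; rewrite /psi xoo addey. Qed.

Context (mu : R) (mu_gt0 : 0 < mu) (psi_sc : strongly_convex mu (psi f A phi)).

Lemma psir_sconvex : sconvex_on mu domphi psir.
Proof.
move=> x y t Dx Dy t01; have [Dz _] := phir_sconvex x y t Dx Dy t01.
split=> //; have := psi_sc x y t t01.
by rewrite !psiE// -!EFinM -EFinD lee_fin vnorm_sqr.
Qed.

Lemma ex_domphi : exists x, domphi x.
Proof. by have [[_ ?]] := phi_pcc. Qed.

Lemma ex_minimiser : (-oo < psistar f A phi)%E ->
  exists2 xs, domphi xs & psistar f A phi = (psir xs)%:E /\
    forall x, domphi x -> psir xs <= psir x.
Proof.
move=> psiN.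
have lb x : domphi x -> (psistar f A phi <= (psir x)%:E)%E.
  by move=> Dx; apply: ereal_inf_lbound; exists x => //; rewrite psiE.
have [x0 Dx0] := ex_domphi.
have fin : psistar f A phi \is a fin_num.
  by rewrite fin_numElt psiN (le_lt_trans (lb _ Dx0)) ?ltry.
have [xs Dxs xsmin] : exists2 x, domphi x & forall y, domphi y -> psir x <= psir y.
  apply: (@sconvex_min _ _ mu (fine (psistar f A phi))) => //.
  - exact: ex_domphi.
  - exact: psir_sconvex.
  - exact: lsc_onD phir_lsc fsum_subgrad.
  - by move=> x Dx; rewrite -lee_fin fineK// lb.
exists xs => //; split=> //; apply/eqP; rewrite eq_le lb//=.
apply: le_ereal_inf_tmp => _ [y _ <-].
have [Dy|nDy] := pselect (domphi y); first by rewrite psiE// lee_fin xsmin.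
by rewrite psi_out// leey.
Qed.

Context (L : R) (gradL : lipK (gradf A g) L).
Context (xs : 'cV[R]_n) (Dxs : domphi xs)
  (xs_min : forall x, domphi x -> psir xs <= psir x).

Lemma psir_growth x : domphi x ->
  psir xs + mu / 2 * dotv (x - xs) (x - xs) <= psir x.
Proof. by move=> Dx; exact: (sconvex_growth _ _ _ _ _ psir_sconvex). Qed.

(** First-order optimality: along the segment from [xs] to [x], convexity of [phi] and the descent
    inequality for [f] leave an error of order [t ^+ 2]. *)
Lemma minimiser_subgrad x : domphi x ->
  phir xs - dotv (gradf A g xs) (x - xs) <= phir x.
Proof.
move=> Dx; rewrite -subr_le0; set h := x - xs.
apply: (@le0_of_small _ _ (L / 2 * dotv h h)) => t /andP[t0 t1].
have [|Dz qz] := phir_sconvex x xs t Dx Dxs; first by rewrite t1 ltW.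
have := xs_min _ Dz; have := descent _ _ _ xs (t *: h) fsum_subgrad gradL.
move: qz; rewrite /psir.
have -> : t *: x + (1 - t) *: xs = xs + t *: h.
  by rewrite scalerBl scale1r scalerBr addrCA.
rewrite !mul0r subr0 !(dotvZl, dotvZr) => h1 h2 h3.
rewrite -(ler_pM2l t0); lra.
Qed.

(** [prox] falls back to [y] unless a minimiser exists, so existence comes first; the inequality is
    then the growth of the 1-strongly convex objective [q]. *)
Lemma prox_spec a y : 0 < a -> domphi (prox a phi y) /\
  forall z, domphi z ->
    a * phir (prox a phi y) + dotv (y - prox a phi y) (z - prox a phi y) <= a * phir z.
Proof.
move GE : (gradf A g xs) => G a0.
pose q x := a * phir x + 2^-1 * dotv (y - x) (y - x).
have q_sc : sconvex_on 1 domphi q.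
  move=> u v t Du Dv t01; have [Dz hz] := phir_sconvex u v t Du Dv t01; split=> //.
  have : a * phir (t *: u + (1 - t) *: v) <= a * (t * phir u + (1 - t) * phir v).
    by rewrite ler_pM2l// (le_trans hz)// !mul0r subr0.
  rewrite /q !(dotvDl, dotvDr, dotvNl, dotvNr, dotvZl, dotvZr).
  rewrite (dotvC u y) (dotvC v y) (dotvC v u); lra.
have q_lsc : lsc_on domphi q.
  apply: (@lsc_onD _ _ _ _ _ (fun x => x - y)).
    move=> x t xt; have [Dx|d d0 hd] := phir_lsc x (t / a).
      by rewrite ltr_pdivrMr// mulrC xt.
    by exists d => // z zd Dz; have := hd z zd Dz; rewrite ltr_pdivrMr// mulrC.
  move=> x z; have := dotvv_ge0 (z - x).
  rewrite !(dotvDl, dotvDr, dotvNl, dotvNr, dotvZl, dotvZr).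
  rewrite (dotvC z x) (dotvC x y) (dotvC z y); lra.
(* The affine minorant of [phi] at [xs] and completion of the square bound [q] from below. *)
have q_bd x : domphi x ->
    a * phir xs - a ^+ 2 / 2 * dotv G G - a * dotv G (y - xs) <= q x.
  move=> Dx; have := minimiser_subgrad x Dx; rewrite GE -(ler_pM2l a0) /q.
  have := dotvv_ge0 (x - y - a *: G).
  rewrite !(dotvDl, dotvDr, dotvNl, dotvNr, dotvZl, dotvZr).
  rewrite (dotvC x y) (dotvC x G) (dotvC y G); lra.
have qE x : domphi x ->
    (a%:E * phi x + (2^-1 * vnorm (y - x) ^+ 2)%R%:E)%E = (q x)%:E.
  by move=> Dx; rewrite phirE// vnorm_sqr.
have [w Dw wmin] : exists2 x, domphi x & forall z, domphi z -> q x <= q z.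
  by apply: (sconvex_min _ _ _ _ ltr01 ex_domphi q_sc q_lsc q_bd).
have : [set w | forall w', (a%:E * phi w + (2^-1 * vnorm (y - w) ^+ 2)%R%:E
    <= a%:E * phi w' + (2^-1 * vnorm (y - w') ^+ 2)%R%:E)%E]%classic (prox a phi y).
  apply: xgetPex; exists w => z /=.
  rewrite qE//; have [Dz|nDz] := pselect (domphi z); first by rewrite qE// lee_fin wmin.
  by rewrite phi_out// gt0_muley ?lte_fin// addye// leey.
move=> /= pmin; set p := prox a phi y in pmin *.
have Dp : domphi p.
  apply: contrapT => nDp; have := pmin xs.
  by rewrite (qE xs)// phi_out// gt0_muley ?lte_fin// addye// leye_eq.
split=> // z Dz.
have pz : forall z, domphi z -> q p <= q z.
  by move=> z' Dz'; rewrite -lee_fin -!qE.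
have := sconvex_growth _ _ _ _ _ q_sc Dp Dz pz; rewrite /q.
rewrite !(dotvDl, dotvDr, dotvNl, dotvNr, dotvZl, dotvZr).
rewrite (dotvC z y) (dotvC p y) (dotvC p z); lra.
Qed.

(** The prox inequality tested at [xs] and the optimality of [xs] tested at [p] give
    [|p - xs| <= (1 + |L|) |x - xs|], as for a nonexpansive map. The sign of [L] is left open, hence
    [|L|]. *)
Lemma Fnat_le x : vnorm (Fnat A g phi x) <= (2 + `|L|) * vnorm (x - xs).
Proof.
rewrite /Fnat; have [Dp hp] := prox_spec 1 (x - gradf A g x) ltr01.
set p := prox _ _ _ in Dp hp *.
have h1 := hp xs Dxs; have h2 := minimiser_subgrad p Dp.
have h3 : vnorm (p - xs) <= (1 + `|L|) * vnorm (x - xs).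
  have [->|pn0] := eqVneq (vnorm (p - xs)) 0.
    by rewrite mulr_ge0 ?vnorm_ge0// addr_ge0.
  have pp : 0 < vnorm (p - xs) by rewrite lt_def pn0 vnorm_ge0.
  rewrite -(ler_pM2r pp) -expr2 vnorm_sqr.
  have c1 := cauchy_schwarz (x - xs) (p - xs).
  have c2 := dotv_ge (gradf A g x - gradf A g xs) (p - xs).
  have c3 : vnorm (gradf A g x - gradf A g xs) * vnorm (p - xs) <=
      `|L| * vnorm (x - xs) * vnorm (p - xs).
    rewrite ler_wpM2r ?vnorm_ge0// (le_trans (gradL _ _))//.
    by rewrite ler_wpM2r ?vnorm_ge0// ler_norm.
  move: h1 h2 c1 c2 c3; rewrite !mul1r.
  set a1 := vnorm _ * _; set a2 := vnorm _ * _; set a3 := _ * _ * vnorm _.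
  rewrite (_ : (1 + `|L|) * _ * _ = a1 + a3); last by rewrite /a1 /a3; ring.
  rewrite !(dotvDl, dotvDr, dotvNl, dotvNr) (dotvC p xs); lra.
have -> : x - p = (x - xs) - (p - xs) by rewrite opprB addrA subrK.
by rewrite (le_trans (vnormD _ _))// vnormN; lra.
Qed.

End Problem.

(** * One inner step *)

Section InnerStep.
Context {R : realType} {n N b : nat} {md : 'I_N -> nat}.
Context (N_gt0 : (0 < N)%N) (b_gt0 : (0 < b)%N).
Context (A : forall i : 'I_N, 'M[R]_(md i, n))
  (f : forall i : 'I_N, 'cV[R]_(md i) -> R)
  (g gs : forall i : 'I_N, 'cV[R]_(md i) -> 'cV[R]_(md i))
  (phi : 'cV[R]_n -> \bar R) (Lc : 'I_N -> R) (L alpha : R) (xs : 'cV[R]_n).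
Context (fg : forall i, is_subgrad (f i) (g i))
  (gL : forall i, 0 <= Lc i /\ lipK (g i) (Lc i))
  (gradL : lipK (gradf A g) L)
  (conj_diff : forall i, ess_diff (fconj (f i)) (gs i) (Ddom (f i)))
  (alpha_gt0 : 0 < alpha) (Dxs : domphi phi xs)
  (proxP : forall y, domphi phi (prox alpha phi y) /\
    forall z, domphi phi z ->
      alpha * phir phi (prox alpha phi y) + dotv (y - prox alpha phi y) (z - prox alpha phi y)
        <= alpha * phir phi z)
  (xs_subgrad : forall x, domphi phi x ->
    phir phi xs - dotv (gradf A g xs) (x - xs) <= phir phi x).

Local Notation T := (b.-tuple 'I_N).
Local Notation psir := (psir A f phi).
Local Notation phir := (phir phi).
Local Notation gradi := (gradi A g).

Let N_neq0 : N%:R != 0 :> R. Proof. by rewrite pnatr_eq0 -lt0n. Qed.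
Let b_neq0 : b%:R != 0 :> R. Proof. by rewrite pnatr_eq0 -lt0n. Qed.

(** A crude common bound for the products [opnorm (A i) * Lc i]; it only affects the size of the
    admissible tolerance. *)
Definition grad_err : R := \sum_i opnorm (A i) * Lc i.

Lemma grad_err_ge0 : 0 <= grad_err.
Proof. by apply: sumr_ge0 => i _; rewrite mulr_ge0 ?opnorm_ge0//; case: (gL i). Qed.

(* [xi j] is the gradient of [f_(S j)] at [gs (xi j)], and the residual bounds
   the distance from that point to [A_(S j) xn]. *)
Lemma batch_grad_err (S : T) (xi : dvec S) x v e :
  (forall j, Ddom (f (tnth S j)) (xi j)) ->
  Vnorm A gs phi alpha x v xi <= e ->
  vnorm (AStxi A xi - gradfS A g S (prox alpha phi (x - alpha *: AStxi A xi + v)))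
    <= grad_err * e.
Proof.
rewrite /Vnorm; set xn := prox _ _ _ => Dxi Ve.
rewrite -scalerBr -sumrB vnormZ ger0_norm ?invr_ge0//.
rewrite -(ler_pM2l (x := b%:R)) ?ltr0n// mulrA divff// mul1r.
rewrite (le_trans (vnorm_sum _ _))//.
rewrite mulr_natl -[X in _ *+ X](card_ord b) -sumr_const; apply: ler_sum => j _.
rewrite -mulmxBr (le_trans (vnorm_trmulmx _ _))//.
have [L0 lip] := gL (tnth S j).
have Vj : vnorm (gs (tnth S j) (xi j) - A (tnth S j) *m xn) <= e.
  apply: le_trans Ve; rewrite -[leLHS]ger0_norm ?vnorm_ge0// -sqrtr_sqr ler_wsqrtr//.
  by rewrite (bigD1 j)//= lerDl sumr_ge0// => l _; rewrite sqr_ge0.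
rewrite -{1}(grad_conj_inv _ _ _ _ _ (fg _) lip (conj_diff _) (Dxi j)).
apply: (@le_trans _ _ (opnorm (A (tnth S j)) * (Lc (tnth S j) * e))).
  by rewrite ler_wpM2l ?opnorm_ge0// (le_trans (lip _ _))// ler_wpM2l.
rewrite mulrA ler_wpM2r// ?(le_trans _ Vj) ?vnorm_ge0//.
rewrite /grad_err (bigD1 (tnth S j))//= lerDl sumr_ge0// => i _.
by rewrite mulr_ge0 ?opnorm_ge0//; case: (gL i).
Qed.

(** The full gradient at [x] minus its variance-reduced estimate. *)
Definition grad_noise (x xt : 'cV[R]_n) (S : T) : 'cV[R]_n :=
  gradf A g x - gradf A g xt - (gradfS A g S x - gradfS A g S xt).

(** The Bregman distance of [f_i] from [x] to [xs], together with the part of the gradient noise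
    tested at [x - xs]. Collected per index, its batch mean minus its full mean is centred. *)
Definition val_noise (x xt : 'cV[R]_n) (i : 'I_N) : R :=
  f i (A i *m xs) - f i (A i *m x) - dotv (gradi i x) (xs - x)
    - dotv (gradi i x - gradi i xt) (x - xs).

Definition batch_noise x xt (S : T) : R :=
  b%:R^-1 * \sum_j val_noise x xt (tnth S j) - N%:R^-1 * \sum_i val_noise x xt i.

Let fS (S : T) x := b%:R^-1 * \sum_j f (tnth S j) (A (tnth S j) *m x).

Lemma dotv_gradfS (S : T) x z :
  dotv (gradfS A g S x) z = b%:R^-1 * \sum_j dotv (gradi (tnth S j) x) z.
Proof. by rewrite dotvZl dotv_suml. Qed.

Let fS_subgrad S : is_subgrad (fS S) (gradfS A g S).
Proof.
move=> x y; rewrite dotv_gradfS -mulrDr -big_split/= ler_wpM2l ?invr_ge0//.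
by apply: ler_sum => i _; exact: gradi_subgrad.
Qed.

Let batch_noiseE x xt S : batch_noise x xt S =
  (fS S xs - fS S x - dotv (gradfS A g S x) (xs - x)
     - dotv (gradfS A g S x - gradfS A g S xt) (x - xs))
  - (fsum f A xs - fsum f A x - dotv (gradf A g x) (xs - x)
     - dotv (gradf A g x - gradf A g xt) (x - xs)).
Proof.
rewrite /batch_noise /val_noise !(dotvDl _ (- _)) !dotvNl !dotv_gradfS !dotv_gradf /fS /fsum.
rewrite -!mulrBr -!sumrB; congr (_ * _ - _ * _); apply: eq_bigr => i _;
by rewrite dotvDl dotvNl.
Qed.

(* The three-point identity for [f_S] leaves a Bregman term at the old iterate,
   whose mean is the one lost by linearising [f] there. *)
Lemma step_ineq S xt x e xn : snspp_step A g f gs phi S alpha xt x e xn ->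
  domphi phi xn /\
  psir xn - psir xs <= (2 * alpha)^-1 * (dotv (x - xs) (x - xs) - dotv (xn - xs) (xn - xs))
    + batch_noise x xt S + dotv (grad_noise x xt S) (xn - x)
    - (alpha^-1 - L) / 2 * dotv (xn - x) (xn - x)
    + grad_err * e * vnorm (xn - xs).
Proof.
case=> xi [Dxi Ve xnE].
have [Dxn hp] := proxP (x - alpha *: AStxi A xi - alpha *: (gradf A g xt - gradfS A g S xt)).
have hE := batch_grad_err _ _ _ _ _ Dxi Ve.
rewrite -xnE in Dxn hp hE; split=> //.
have {hp} hprox := hp xs Dxs.
have hF := descent _ _ _ x (xn - x) (fsum_subgrad A f g fg) gradL.
have hS1 := fS_subgrad S xn xs.
have hS2 := fS_subgrad S x xn.
rewrite batch_noiseE /grad_noise /psir.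
move: hE hprox hF hS1 hS2; rewrite [x + (xn - x)]addrC subrK.
move: (AStxi A xi) (gradf A g x) (gradf A g xt) (gradfS A g S x) (gradfS A g S xt)
  (gradfS A g S xn) => d a at_ s st sn hE.
have hErr : dotv (d - sn) (xs - xn) <= grad_err * e * vnorm (xn - xs).
  rewrite (le_trans (cauchy_schwarz _ _))// (vnormB xs xn).
  by rewrite ler_wpM2r ?vnorm_ge0.
rewrite -(ler_pM2l (x := alpha^-1)) ?invr_gt0// => hprox.
have {}hprox : phir xn + alpha^-1 * dotv (x - xn) (xs - xn) - dotv (d + at_ - st) (xs - xn) <= phir xs.
  have e1 : alpha^-1 * (alpha * phir xs) = phir xs by rewrite mulKf// gt_eqF.
  rewrite e1 in hprox; apply: le_trans hprox.
  have -> : x - alpha *: d - alpha *: (at_ - st) - xn = (x - xn) - alpha *: (d + at_ - st).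
    by apply/matrixP => i j; rewrite !mxE; ring.
  rewrite [dotv (_ - alpha *: _) _]dotvDl dotvNl dotvZl mulrDr mulrBr !mulKf ?gt_eqF//; lra.
have -> : (2 * alpha)^-1 = alpha^-1 / 2 by rewrite invfM mulrC.
move: hErr hprox; move: (alpha^-1) (grad_err * e * _) => ia er.
rewrite !(dotvDl, dotvDr, dotvNl, dotvNr).
rewrite (dotvC xs x) (dotvC xn x) (dotvC xn xs); lra.
Qed.

Lemma sum_batch_noise x xt : \sum_S batch_noise x xt S = 0.
Proof.
rewrite sumrB (sum_batch_mean N_gt0 b_gt0 (val_noise x xt)) sumr_const.
by rewrite -[X in _ - X]mulr_natl subrr.
Qed.

Lemma le_Lbar i : Lc i * opnorm (A i) ^+ 2 <= Lbar A Lc.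
Proof. by apply: le_bigmax. Qed.

Lemma Lbar_ge0 : 0 <= Lbar A Lc.
Proof. exact: bigmax_ge_id. Qed.

Lemma gradi_cocoercive i x y :
  dotv (gradi i x - gradi i y) (gradi i x - gradi i y) <=
  2 * Lbar A Lc * (f i (A i *m x) - f i (A i *m y) - dotv (gradi i y) (x - y)).
Proof.
have [L0 lip] := gL i.
have D0 : 0 <= f i (A i *m x) - f i (A i *m y) - dotv (gradi i y) (x - y).
  by have := gradi_subgrad A f g fg i y x; lra.
apply: (@le_trans _ _ (2 * (Lc i * opnorm (A i) ^+ 2) *
  (f i (A i *m x) - f i (A i *m y) - dotv (gradi i y) (x - y)))); last first.
  by rewrite ler_wpM2r// ler_wpM2l// le_Lbar.
rewrite -mulmxBr -vnorm_sqr.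
apply: (@le_trans _ _ ((opnorm (A i) * vnorm (g i (A i *m x) - g i (A i *m y))) ^+ 2)).
  by rewrite ler_pXn2r// ?nnegrE ?mulr_ge0 ?opnorm_ge0 ?vnorm_ge0// vnorm_trmulmx.
rewrite exprMn vnorm_sqr.
have := cocoercive _ _ _ (A i *m x) (A i *m y) L0 (fg i) lip.
rewrite -mulmxBr dotvC dotv_mulmx (dotvC (x - y)) => h.
have := ler_wpM2l (sqr_ge0 (opnorm (A i))) h; rewrite /gradi; lra.
Qed.

(** Averaged cocoercivity gives the Bregman distance of [f] at [xs], and optimality of [xs] bounds
    this by the gap of [psi]. *)
Lemma mean_gradi_dist x : domphi phi x ->
  N%:R^-1 * \sum_i dotv (gradi i x - gradi i xs) (gradi i x - gradi i xs)
    <= 2 * Lbar A Lc * (psir x - psir xs).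
Proof.
move=> Dx.
apply: (@le_trans _ _ (2 * Lbar A Lc *
    (fsum f A x - fsum f A xs - dotv (gradf A g xs) (x - xs)))); last first.
  rewrite ler_wpM2l ?mulr_ge0 ?Lbar_ge0//.
  by have := xs_subgrad x Dx; rewrite /psir; lra.
rewrite dotv_gradf /fsum -!mulrBr -!sumrB mulrCA ler_wpM2l ?invr_ge0// mulr_sumr.
by apply: ler_sum => i _; exact: gradi_cocoercive.
Qed.

(** The noise is a centred batch mean of [gradi i xt - gradi i x]. Passing through [xs] by
    [|p - q|^2 <= 2 |p - r|^2 + 2 |q - r|^2] doubles the factor 2 of cocoercivity. *)
Lemma sum_grad_noise x xt : domphi phi x -> domphi phi xt ->
  \sum_S dotv (grad_noise x xt S) (grad_noise x xt S) <=
  #|{: T}|%:R * (4 * Lbar A Lc / b%:R * ((psir x - psir xs) + (psir xt - psir xs))).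
Proof.
move=> Dx Dxt.
pose w i := gradi i xt - gradi i x.
have noiseE S : grad_noise x xt S = b%:R^-1 *: (\sum_j w (tnth S j)) - N%:R^-1 *: \sum_i w i.
  rewrite /w !sumrB !scalerBr /grad_noise /gradf /gradfS -/(gradi _ _).
  by rewrite !opprB addrC.
apply: (le_trans (sum_batch_variance N_gt0 b_gt0 _ w _ noiseE)).
rewrite ler_wpM2l// [4 * _ / _]mulrC -mulrA ler_wpM2l ?invr_ge0//.
apply: (@le_trans _ _ (2 * (N%:R^-1 * \sum_i dotv (gradi i x - gradi i xs) (gradi i x - gradi i xs))
  + 2 * (N%:R^-1 * \sum_i dotv (gradi i xt - gradi i xs) (gradi i xt - gradi i xs)))).
  rewrite -mulrDr -mulrDr -big_split/= mulrCA ler_wpM2l ?invr_ge0// mulr_sumr.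
  apply: ler_sum => i _; rewrite /w.
  move: (gradi i x) (gradi i xt) (gradi i xs) => p q r.
  have := dotvv_ge0 (p + q - r - r).
  rewrite !(dotvDl, dotvDr, dotvNl, dotvNr) (dotvC q p) (dotvC r p) (dotvC r q); lra.
have := mean_gradi_dist x Dx; have := mean_gradi_dist xt Dxt; lra.
Qed.

End InnerStep.

(** * One epoch *)

Lemma sconvex_mean {R : realType} {p : nat} (mu : R) (D : set 'cV[R]_p) q
    (x : nat -> 'cV[R]_p) (m : nat) : 0 <= mu -> sconvex_on mu D q ->
  (forall k, (k < m.+1)%N -> D (x k)) ->
  D (m.+1%:R^-1 *: \sum_(k < m.+1) x k) /\
  q (m.+1%:R^-1 *: \sum_(k < m.+1) x k) <= m.+1%:R^-1 * \sum_(k < m.+1) q (x k).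
Proof.
move=> mu0 sc; elim: m => [|m IH] Dx.
  by rewrite !big_ord1 invr1 scale1r mul1r; split => //; exact: Dx.
have [Dm qm] := IH (fun k km => Dx k (ltnW km)).
set t : R := m.+2%:R^-1.
have m1 : m.+1%:R != 0 :> R by rewrite pnatr_eq0.
have m2 : m.+2%:R != 0 :> R by rewrite pnatr_eq0.
have t01 : 0 <= t <= 1 by rewrite invr_ge0 ler0n/= invf_le1 ?ltr0n// ler1n.
(* The new point gets weight [t], and rescaling the old mean by [1 - t] gives each old point the
   same weight. *)
have tE : (1 - t) * m.+1%:R^-1 = t.
  have tm : (m.+1%:R + 1) * t = 1 by rewrite natr1 divff.
  by apply: (mulIf m1); rewrite divfK//; lra.
have sE : \sum_(k < m.+2) x k = x m.+1 + \sum_(k < m.+1) x k.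
  by rewrite big_ord_recr addrC.
have [] := sc (x m.+1) _ t (Dx _ (ltnSn _)) Dm t01.
rewrite scalerA tE -scalerDr -sE => Dm' qm'; split=> //.
have qE : \sum_(k < m.+2) q (x k) = \sum_(k < m.+1) q (x k) + q (x m.+1).
  by rewrite big_ord_recr.
apply: (le_trans qm'); rewrite qE mulrDr.
have h := dotvv_ge0 (x m.+1 - m.+1%:R^-1 *: \sum_(i < m.+1) x i).
have [t0 t1] := andP t01.
have h1 : 0 <= mu / 2 * t * (1 - t) * dotv (x m.+1 - m.+1%:R^-1 *: \sum_(i < m.+1) x i)
  (x m.+1 - m.+1%:R^-1 *: \sum_(i < m.+1) x i).
  by rewrite !mulr_ge0// subr_ge0.
have h2 : (1 - t) * q (m.+1%:R^-1 *: \sum_(i < m.+1) x i) <= t * \sum_(i < m.+1) q (x i).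
  apply: (@le_trans _ _ ((1 - t) * (m.+1%:R^-1 * \sum_(i < m.+1) q (x i)))).
    by rewrite ler_wpM2l// subr_ge0.
  by rewrite mulrA tE.
lra.
Qed.

(* [c = 2 / kappa <= 2 / 7] since [kappa >= 7]; the weight [1 / 56] of the tolerance
   errors and the start-up cost [B <= m / 28] are chosen so that the factor is at
   most [1 / 2 <= 1 - theta]. *)
Lemma epoch_recursion {R : realType} (a nn : nat -> R) (m : nat) (ia B c theta : R) :
  0 <= ia -> 0 <= c <= 2 / 7 -> theta <= 2^-1 ->
  (forall k, 0 <= a k) -> (forall k, 0 <= nn k) ->
  (forall k, (k < m)%N -> a k.+1 <= ia * (nn k - nn k.+1) + c * (a k + a 0%N)
     + 56^-1 * (a 0%N + a k.+1)) ->
  ia * nn 0%N + c * a 0%N <= B * a 0%N -> 28 * B <= m%:R ->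
  \sum_(k < m) a k.+1 <= (1 - theta) * m%:R * a 0%N.
Proof.
move=> ia0 /andP[c0 c1] th a0 n0 rec nB mB.
(* The term [c * a k] on the left cancels the one in the next instance of the recursion, and the
   distances telescope. *)
have inv k : (k <= m)%N -> (1 - 56^-1 - c) * \sum_(j < k) a j.+1 + c * a k + ia * nn k
    <= ia * nn 0%N + c * a 0%N + (c + 56^-1) * k%:R * a 0%N.
  elim: k => [_|k IH km]; first by rewrite big_ord0; lra.
  have := IH (ltnW km); have := rec k km.
  rewrite big_ord_recr/= -[k.+1%:R]natr1; lra.
have := inv m (leqnn m); have := mulr_ge0 c0 (a0 m); have := mulr_ge0 ia0 (n0 m).
have s0 : 0 <= \sum_(k < m) a k.+1 by apply: sumr_ge0.
have := ler_wpM2r (a0 0%N) mB.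
have ma : 0 <= m%:R * a 0%N by rewrite mulr_ge0.
set s := \sum_(k < m) _ in s0 *; rewrite -!mulrA.
have := a0 0%N.
set u := m%:R * a 0%N in ma * => a00 h1 h2 h3 h4.
have q0 : 0 < 1 - 56^-1 - c by lra.
(* Here [3 / 56] is [1 / 56] from the tolerance plus [1 / 28] from the start-up cost; [h6] then
   amounts to [c <= 7 / 24]. *)
have h5 : (1 - 56^-1 - c) * s <= (c + 3 / 56) * u by lra.
have h6 : (c + 3 / 56) <= (1 - 56^-1 - c) / 2 by lra.
have h7 : (c + 3 / 56) * u <= (1 - 56^-1 - c) / 2 * u by rewrite ler_wpM2r.
have h8 : s <= u / 2 by rewrite -(ler_pM2l q0); lra.
by apply: (le_trans h8); rewrite mulrC ler_wpM2r//; lra.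
Qed.

Section Epoch.
Context {R : realType} {n N b : nat} {md : 'I_N -> nat}.
Context (N_gt0 : (0 < N)%N) (b_gt0 : (0 < b)%N).
Context (A : forall i : 'I_N, 'M[R]_(md i, n))
  (f : forall i : 'I_N, 'cV[R]_(md i) -> R)
  (g gs : forall i : 'I_N, 'cV[R]_(md i) -> 'cV[R]_(md i))
  (phi : 'cV[R]_n -> \bar R) (Lc : 'I_N -> R) (L mu alpha : R) (xs : 'cV[R]_n).
Context (fg : forall i, is_subgrad (f i) (g i))
  (gL : forall i, 0 <= Lc i /\ lipK (g i) (Lc i))
  (gradL : lipK (gradf A g) L)
  (conj_diff : forall i, ess_diff (fconj (f i)) (gs i) (Ddom (f i)))
  (mu_gt0 : 0 < mu) (alpha_gt0 : 0 < alpha) (Dxs : domphi phi xs)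
  (proxP : forall y, domphi phi (prox alpha phi y) /\
    forall z, domphi phi z ->
      alpha * phir phi (prox alpha phi y) + dotv (y - prox alpha phi y) (z - prox alpha phi y)
        <= alpha * phir phi z)
  (xs_subgrad : forall x, domphi phi x ->
    phir phi xs - dotv (gradf A g xs) (x - xs) <= phir phi x)
  (xs_min : forall x, domphi phi x -> psir A f phi xs <= psir A f phi x)
  (growth : forall x, domphi phi x ->
    psir A f phi xs + mu / 2 * dotv (x - xs) (x - xs) <= psir A f phi x)
  (Fnat_lip : forall x, vnorm (Fnat A g phi x) <= (2 + `|L|) * vnorm (x - xs)).
Context (kappa delta : R) (kappa_gt0 : 0 < kappa)
  (alpha_le : L + Lbar A Lc / b%:R * kappa <= alpha^-1)
  (delta_gt0 : 0 < delta)
  (delta_le : grad_err A Lc * delta * (2 + `|L|) / mu <= 56^-1).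

Local Notation T := (b.-tuple 'I_N).
Local Notation gap x := (psir A f phi x - psir A f phi xs).

(** The weight in Young's inequality: by [alpha_le] it is at most [alpha^-1 - L], so the term in
    [xn - x] is absorbed. *)
Let tau : R := Lbar A Lc / b%:R * kappa.

Let b_neq0 : b%:R != 0 :> R. Proof. by rewrite pnatr_eq0 -lt0n. Qed.

(** What remains of the noise after Young's inequality no longer involves [xn], so it can be
    averaged over the fresh batch. *)
Definition total_noise (x xt : 'cV[R]_n) (S : T) : R :=
  batch_noise A f g xs x xt S
  + (2 * tau)^-1 * dotv (grad_noise A g x xt S) (grad_noise A g x xt S).

Lemma grad_noise0 x xt (S : T) : Lbar A Lc = 0 -> grad_noise A g x xt S = 0.
Proof.
move=> Lb0.
have gxE i : gradi A g i x = gradi A g i xt.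
  apply/eqP; rewrite -subr_eq0; apply/eqP/vnorm_eq0/eqP.
  rewrite -sqrf_eq0 vnorm_sqr eq_le dotvv_ge0 andbT.
  have := gradi_cocoercive A f g Lc fg gL i x xt.
  by rewrite Lb0 mulr0 mul0r.
rewrite /grad_noise /gradf /gradfS (eq_bigr _ (fun i _ => gxE i)).
by rewrite [in X in _ - X](eq_bigr _ (fun j _ => gxE (tnth S j))) !subrr.
Qed.

Lemma step_gap S x xt e xn :
  snspp_step A g f gs phi S alpha xt x e xn -> domphi phi xt ->
  0 <= e <= delta * vnorm (Fnat A g phi xt) ->
  domphi phi xn /\
  gap xn <= (2 * alpha)^-1 * (dotv (x - xs) (x - xs) - dotv (xn - xs) (xn - xs))
    + total_noise x xt S + 56^-1 * (gap xt + gap xn).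
Proof.
move=> st Dxt /andP[e0 eF].
have [Dxn h] := step_ineq b_gt0 A f g gs phi Lc L alpha xs fg gL gradL conj_diff alpha_gt0 Dxs proxP
  _ _ _ _ _ st; split=> //.
apply: (le_trans h).
have tau0 : 0 <= tau.
  by rewrite mulr_ge0 ?divr_ge0 ?Lbar_ge0// ltW.
have hu : dotv (grad_noise A g x xt S) (xn - x) <= tau / 2 * dotv (xn - x) (xn - x)
    + (2 * tau)^-1 * dotv (grad_noise A g x xt S) (grad_noise A g x xt S).
  have [t0|tn0] := eqVneq tau 0.
    have Lb0 : Lbar A Lc = 0.
      by apply/eqP; move/eqP: t0; rewrite !mulf_eq0 invr_eq0 (negPf b_neq0) (gt_eqF kappa_gt0) !orbF.
    by rewrite grad_noise0// !dotv0l t0 mul0r mulr0 mul0r addr0.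
  by apply: young; rewrite lt_def tn0.
have hx : (tau / 2) * dotv (xn - x) (xn - x) <= (alpha^-1 - L) / 2 * dotv (xn - x) (xn - x).
  by rewrite ler_wpM2r ?dotvv_ge0//; have := alpha_le; rewrite -/tau; lra.
(* The tolerance is at most a multiple of [|xt - xs|]; its product with [|xn - xs|] splits into
   squares, which quadratic growth turns into gaps. *)
have he : grad_err A Lc * e * vnorm (xn - xs) <= 56^-1 * (gap xt + gap xn).
  have G0 := grad_err_ge0 A g Lc gL.
  have c0 : 0 <= grad_err A Lc * delta * (2 + `|L|).
    by rewrite mulr_ge0 ?addr_ge0// mulr_ge0// ltW.
  apply: (@le_trans _ _ (grad_err A Lc * delta * (2 + `|L|) *
      ((dotv (xt - xs) (xt - xs) + dotv (xn - xs) (xn - xs)) / 2))).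
    apply: (@le_trans _ _ (grad_err A Lc * delta * (2 + `|L|) *
        (vnorm (xt - xs) * vnorm (xn - xs)))); last first.
      rewrite ler_wpM2l// -!vnorm_sqr.
       have := sqr_ge0 (vnorm (xt - xs) - vnorm (xn - xs)); nra.
    rewrite [leRHS]mulrA ler_wpM2r ?vnorm_ge0// -!mulrA ler_wpM2l//.
    by rewrite (le_trans eF)// (ler_wpM2l (ltW delta_gt0)).
  have gt := growth xt Dxt; have gn := growth xn Dxn.
  apply: (@le_trans _ _ (grad_err A Lc * delta * (2 + `|L|) / mu * (gap xt + gap xn))).
    rewrite -[_ / mu * _]mulrA ler_wpM2l//.
    by rewrite [leRHS]mulrC ler_pdivlMr//; lra.
  rewrite ler_wpM2r// addr_ge0// subr_ge0; exact: xs_min.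
rewrite /total_noise; lra.
Qed.

(** The batch noise is centred, and [4 Lbar / b] times [(2 * tau)^-1] is [2 / kappa]. If [Lbar] is
    0, so is that inverse. *)
Lemma sum_total_noise x xt : domphi phi x -> domphi phi xt ->
  \sum_S total_noise x xt S <= #|{: T}|%:R * (2 / kappa * (gap x + gap xt)).
Proof.
move=> Dx Dxt; rewrite big_split/= (sum_batch_noise N_gt0 b_gt0) add0r -mulr_sumr.
have g0 : 0 <= gap x + gap xt by rewrite addr_ge0// subr_ge0 xs_min.
have h := sum_grad_noise N_gt0 b_gt0 A f g phi Lc xs fg gL xs_subgrad x xt Dx Dxt.
have [Lb0|Lbn0] := eqVneq (Lbar A Lc) 0.
  rewrite /tau Lb0 !mul0r mulr0 invr0 mul0r.
  by rewrite !mulr_ge0// invr_ge0 ltW.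
have tau0 : 0 <= (2 * tau)^-1.
  by rewrite invr_ge0 mulr_ge0// mulr_ge0 ?divr_ge0 ?Lbar_ge0// ltW.
apply: (le_trans (ler_wpM2l tau0 h)).
rewrite mulrCA ler_wpM2l// mulrA ler_wpM2r// /tau le_eqVlt; apply/orP; left; apply/eqP.
by field; rewrite b_neq0 Lbn0 gt_eqF.
Qed.

(** Here [w] holds all draws, those of earlier epochs included, and [coord k] is the draw of step
    [k], on which neither [X 0] nor [X k] may depend. *)
Lemma epoch_contraction (I : finType) (m : nat) (coord : nat -> I)
    (X : nat -> {ffun I -> T} -> 'cV[R]_n) (e : nat -> {ffun I -> T} -> R) (theta : R) :
  2 / kappa <= 2 / 7 -> theta <= 2^-1 ->
  28 * ((alpha * mu)^-1 + 2 / kappa) <= m%:R ->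
  (forall w, domphi phi (X 0%N w)) ->
  (forall k w, (k < m)%N -> 0 <= e k w <= delta * vnorm (Fnat A g phi (X 0%N w))) ->
  (forall k (w w' : {ffun I -> T}), (k < m)%N -> (forall i, i != coord k -> w i = w' i) ->
     X 0%N w = X 0%N w' /\ X k w = X k w') ->
  (forall k (w : {ffun I -> T}), (k < m)%N ->
     snspp_step A g f gs phi (w (coord k)) alpha (X 0%N w) (X k w) (e k w) (X k.+1 w)) ->
  (forall k w, (k <= m)%N -> domphi phi (X k w)) /\
  \sum_(k < m) \sum_w gap (X k.+1 w) <= (1 - theta) * m%:R * \sum_w gap (X 0%N w).
Proof.
move=> kap th mB D0 he indep step.
have DX k w : (k <= m)%N -> domphi phi (X k w).
  case: k => // k km.
  by have [] := step_gap _ _ _ _ _ (step k w km) (D0 w) (he k w km).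
split=> //.
(* The recursion lemma wants non-negativity for all [k], but gaps are controlled only up to [m]. *)
pose a k := if (k <= m)%N then \sum_w gap (X k w) else 0.
pose nn k := \sum_w dotv (X k w - xs) (X k w - xs).
have aE k : (k <= m)%N -> a k = \sum_w gap (X k w) by rewrite /a => ->.
under eq_bigr => k _ do rewrite -aE//.
rewrite -aE//.
have T_gt0 : 0 < #|{: T}|%:R :> R.
  by rewrite ltr0n card_tuple card_ord expn_gt0 N_gt0.
apply: (@epoch_recursion _ a nn m (2 * alpha)^-1 ((alpha * mu)^-1 + 2 / kappa) (2 / kappa)) => //.
- by rewrite invr_ge0 mulr_ge0// ltW.
- by rewrite kap divr_ge0// ltW.
- move=> k; rewrite /a; case: ifP => // km.
  by apply: sumr_ge0 => w _; rewrite subr_ge0; apply: xs_min; exact: DX.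
- by move=> k; apply: sumr_ge0 => w _; exact: dotvv_ge0.
- move=> k km.
  rewrite !aE// ?(ltnW km)//.
  have noise : \sum_w total_noise (X k w) (X 0%N w) (w (coord k)) <=
      2 / kappa * (\sum_w gap (X k w) + \sum_w gap (X 0%N w)).
    rewrite -(ler_pM2l T_gt0).
    rewrite (@sum_ffun_resample R _ _ (coord k) (fun w S => total_noise (X k w) (X 0%N w) S)).
      rewrite -big_split/= mulr_sumr mulr_sumr; apply: ler_sum => w _.
      by apply: sum_total_noise => //; apply: DX; exact: ltnW.
    by move=> w w' S /(indep k w w' km)[-> ->].
  apply: (le_trans (ler_sum _ (fun w _ =>
    (step_gap _ _ _ _ _ (step k w km) (D0 w) (he k w km)).2))).
  have -> (F : {ffun I -> T} -> R) : \sum_w ((2 * alpha)^-1 * (dotv (X k w - xs) (X k w - xs)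
        - dotv (X k.+1 w - xs) (X k.+1 w - xs)) + F w + 56^-1 * (gap (X 0%N w) + gap (X k.+1 w)))
      = (2 * alpha)^-1 * (nn k - nn k.+1) + \sum_w F w
        + 56^-1 * (\sum_w gap (X 0%N w) + \sum_w gap (X k.+1 w)).
    by rewrite /nn -sumrB -[in RHS]big_split/= !mulr_sumr -!big_split.
  lra.
(* Quadratic growth bounds the initial distance term by [(alpha * mu)^-1] times the initial gap. *)
- rewrite [leRHS]mulrDl lerD2r aE// mulr_sumr mulr_sumr; apply: ler_sum => w _.
  have := growth (X 0%N w) (D0 w); rewrite invfM invfM => h.
  have ia : 0 < alpha^-1 by rewrite invr_gt0.
  rewrite -!mulrA [2^-1 * _]mulrCA (ler_wpM2l (ltW ia))//.
  by rewrite [leRHS]mulrC ler_pdivlMr//; lra.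
Qed.

End Epoch.

(** * Sample paths as finite arrays of draws, and the contraction *)

Lemma ext_samplesE (N b m T : nat) (d : b.-tuple 'I_N)
    (w : {ffun 'I_T * 'I_m -> b.-tuple 'I_N}) (i : 'I_T) (j : 'I_m) :
  ext_samples d w i j = w (i, j).
Proof. by rewrite /ext_samples !valK. Qed.

Lemma ext_samples_agree (N b m T : nat) (d : b.-tuple 'I_N)
    (w w' : {ffun 'I_T * 'I_m -> b.-tuple 'I_N}) (c : 'I_T * 'I_m) s k :
  (forall i, i != c -> w i = w' i) -> (s, k) != (val c.1, val c.2) ->
  ext_samples d w s k = ext_samples d w' s k.
Proof.
move=> ww' sk; rewrite /ext_samples.
case: insubP => [i _ iE|//]; case: insubP => [j _ jE|//].
by apply: ww'; apply: contra sk => /eqP <-; rewrite /= iE jE.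
Qed.

Theorem theorem6p3 (R : realType) (n N : nat) (hN : (0 < N)%N) (md : 'I_N -> nat)
  (A : forall i : 'I_N, 'M[R]_(md i, n))
  (f : forall i : 'I_N, 'cV[R]_(md i) -> R)
  (g : forall i : 'I_N, 'cV[R]_(md i) -> 'cV[R]_(md i))
  (gs : forall i : 'I_N, 'cV[R]_(md i) -> 'cV[R]_(md i))
  (phi : 'cV[R]_n -> \bar R)
  (Lc : 'I_N -> R) (L mu nu alpha theta : R) (b : nat) :
  (* (A1) with gamma_i = 0: f_i is L_i-smooth (g i = grad f_i) and convex *)
  (forall i, has_grad (f i) (g i)) ->
  (forall i, 0 <= Lc i /\ lipK (g i) (Lc i)) ->
  (forall i, convex_fun (f i)) ->
  (* L is a Lipschitz constant of grad f *)
  lipK (gradf A g) L ->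
  (* phi proper closed convex *)
  proper_closed_convex phi ->
  (* (A2) *)
  (-oo < psistar f A phi)%E ->
  (* (A4): hat f_i^* = f_i^* essentially differentiable, gradient gs i locally Lipschitz on D_i *)
  (forall i, ess_diff (fconj (f i)) (gs i) (Ddom (f i)) /\ loc_lip_on (gs i) (Ddom (f i))) ->
  (* (A~3), (A~5) *)
  0 < nu <= 1 ->
  (forall a : R, 0 < a -> forall x, semismooth_at nu (prox a phi) x) ->
  (forall i y, Ddom (f i) y -> semismooth_at nu (gs i) y) ->
  (* psi mu-strongly convex *)
  0 < mu -> strongly_convex mu (psi f A phi) ->
  (* step size, batch size, theta *)
  0 < alpha -> (0 < b)%N -> 0 < theta < 2^-1 ->
  alpha <= (L + Lbar A Lc / b%:R * (4 / (1 - 2 * theta) + 3))^-1 ->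
  exists2 dbar : R, 0 < dbar & exists mbar : nat,
  forall (m : nat) (x0 : 'cV[R]_n) (delta : nat -> R)
         (eps : @samples N b -> nat -> nat -> R)
         (x : @samples N b -> nat -> nat -> 'cV[R]_n),
    (mbar <= m)%N ->
    (forall s, 0 < delta s <= dbar) ->
    (forall om s k, 0 <= eps om s k <= delta s * vnorm (Fnat A g phi (x om s 0%N))) ->
    snspp_run A g f gs phi alpha m x0 eps x ->
    forall s : nat,
      (Expect m s.+1 (deftuple b hN) (fun om => psi f A phi (x om s.+1 0%N) - psistar f A phi)
       <= (1 - theta)%:E *
          Expect m s.+1 (deftuple b hN) (fun om => psi f A phi (x om s 0%N) - psistar f A phi))%E.
Proof.
move=> fgrad gL fconv gradL phi_pcc psi_bdd conj _ _ _ mu0 psi_sc alpha0 b0 /andP[th0 th1] alpha_le.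
have fg i := convex_subgrad _ _ (fgrad i) (fconv i).
have conj_diff i := (conj i).1.
have [xs Dxs [psiE_star xs_min]] := ex_minimiser A f g phi fg phi_pcc mu mu0 psi_sc psi_bdd.
have xs_subgrad := minimiser_subgrad A f g phi fg phi_pcc L gradL xs Dxs xs_min.
have growth := psir_growth A f phi phi_pcc mu psi_sc xs Dxs xs_min.
have proxP y := prox_spec A f g phi fg phi_pcc L gradL xs Dxs xs_min alpha y alpha0.
have Fnat_lip := Fnat_le A f g phi fg phi_pcc L gradL xs Dxs xs_min.
set kappa := 4 / (1 - 2 * theta) + 3 in alpha_le.
have th2 : 0 < 1 - 2 * theta by lra.
have kappa7 : 7 <= kappa.
  suff : 4 <= 4 / (1 - 2 * theta) by rewrite /kappa; lra.
  by rewrite ler_pdivlMr//; lra.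
have kappa0 : 0 < kappa by lra.
have kap : 2 / kappa <= 2 / 7 by rewrite ler_pM2l// lef_pV2 ?posrE.
have alpha_inv : L + Lbar A Lc / b%:R * kappa <= alpha^-1.
  (* Positivity of [alpha] forces the bracket to be positive, so the bound can be inverted. *)
  have s0 : 0 < (L + Lbar A Lc / b%:R * kappa)^-1 by exact: lt_le_trans alpha_le.
  by rewrite -[leLHS]invrK lef_pV2 ?posrE.
have G0 := grad_err_ge0 A g Lc gL.
have L2 : 0 < 2 + `|L| by have := normr_ge0 L; lra.
have G1 : 0 < grad_err A Lc + 1 by lra.
(* Chosen to give the tolerance errors weight at most [1 / 56]; the [+ 1] keeps the denominator
   positive. *)
pose dbar := mu / (56 * (grad_err A Lc + 1) * (2 + `|L|)).
have dbar0 : 0 < dbar by rewrite divr_gt0// !mulr_gt0.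
pose B := 28 * ((alpha * mu)^-1 + 2 / kappa).
exists dbar => //; exists (Num.truncn B).+1 => m x0 delta eps x mB hdelta heps [causal _ avg step] s.
have m_gt0 : (0 < m)%N by exact: leq_trans mB.
have mBR : B <= m%:R.
  by apply/ltW/(lt_le_trans (truncnS_gt _)); rewrite ler_nat.
pose d := deftuple b hN.
pose W := {ffun 'I_s.+1 * 'I_m -> b.-tuple 'I_N}.
pose X k (w : W) := x (ext_samples d w) s k.
have gap_in y : domphi phi y ->
    (psi f A phi y - psistar f A phi = (psir A f phi y - psir A f phi xs)%:E)%E.
  by move=> Dy; rewrite psiE_star psiE.
have gap_out y : ~ domphi phi y -> (psi f A phi y - psistar f A phi = +oo)%E.
  by move=> nDy; rewrite psiE_star psi_out.
have gap_ge0 y : (0 <= psi f A phi y - psistar f A phi)%E.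
  have [Dy|nDy] := pselect (domphi phi y); last by rewrite gap_out.
  by rewrite gap_in// lee_fin subr_ge0 xs_min.
have cW : 0 < #|{: W}|%:R^-1 :> R.
  by rewrite invr_gt0 ltr0n; apply/card_gt0P; exists [ffun=> d].
have th3 : 0 < 1 - theta by lra.
rewrite /Expect -/W -/d.
(* As [x0] is arbitrary, an epoch may start outside the domain of [phi]; the right side is then
   [+oo]. *)
have [D0|] := pselect (forall w, domphi phi (X 0%N w)); last first.
  move=> /existsNP[w nD].
  rewrite [in leRHS](bigD1 w)//= (gap_out _ nD).
  rewrite addye; last first.
    by rewrite -ltNye (lt_le_trans (ltNyr 0))// sume_ge0.
  by rewrite !gt0_muley ?lte_fin// leey.
have [dl0 dl] := andP (hdelta s).
have dl' : grad_err A Lc * delta s * (2 + `|L|) / mu <= 56^-1.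
  rewrite ler_pdivrMr//.
  have : delta s * (56 * (grad_err A Lc + 1) * (2 + `|L|)) <= mu.
    by rewrite -ler_pdivlMr// !mulr_gt0.
  have : 0 <= delta s * (2 + `|L|) by rewrite mulr_ge0// ltW.
  lra.
(* Epoch [s] is the last of the [s.+1] rows of draws; the [insubd] default occurs only for
   [k >= m]. *)
pose coord k : 'I_s.+1 * 'I_m := (ord_max, insubd (Ordinal m_gt0) k).
have coordE k : (k < m)%N -> val (coord k).2 = k.
  by move=> km; rewrite val_insubd km.
have [||DX main] := epoch_contraction hN b0 A f g gs phi Lc L mu alpha xs fg gL gradL
  conj_diff mu0 alpha0 Dxs proxP xs_subgrad xs_min growth Fnat_lip kappa (delta s) kappa0
  alpha_inv dl0 dl' _ m coord X (fun k w => eps (ext_samples d w) s k) theta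
  kap (ltW th1) mBR D0 (fun k w _ => heps _ s k) _ _.
(* Causality: neither the start of the epoch nor the iterate [k] sees the draw at [(s, k)]. *)
- move=> k w w' km ww'; split; apply: causal => s' k'.
    rewrite ltn0 andbF orbF => ss.
    by apply: (@ext_samples_agree _ _ _ _ _ _ _ (coord k)) => //; rewrite xpair_eqE /= ltn_eqF.
  move=> sk; apply: (@ext_samples_agree _ _ _ _ _ _ _ (coord k)) => //.
  rewrite xpair_eqE coordE//=; case/orP: sk => [ss|/andP[_ kk]]; first by rewrite ltn_eqF.
  by rewrite (ltn_eqF kk) andbF.
- move=> k w km; have := step (ext_samples d w) s k km.
  have -> : ext_samples d w s k = w (coord k) by rewrite -{1}(coordE k km) -(ext_samplesE _ _ _ _ d w).
  exact.
case: m m_gt0 @d @W @X @coord cW D0 DX main mBR mB avg step coordE causal heps => // m m_gt0 d W X coord cW D0 DX main mBR mB avg step coordE causal heps.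
have mean w := sconvex_mean mu _ _ (fun k => X k.+1 w) m (ltW mu0)
  (psir_sconvex A f phi phi_pcc mu psi_sc) (fun k km => DX k.+1 w km).
have -> : (\sum_(w : W) (psi f A phi (x (ext_samples d w) s.+1 0%N) - psistar f A phi) =
    (\sum_(w : W) (psir A f phi (x (ext_samples d w) s.+1 0%N) - psir A f phi xs))%R%:E)%E.
  rewrite -sumEFin; apply: eq_bigr => w _; rewrite gap_in//.
  by rewrite avg; case: (mean w).
have -> : (\sum_(w : W) (psi f A phi (x (ext_samples d w) s 0%N) - psistar f A phi) =
    (\sum_(w : W) (psir A f phi (X 0%N w) - psir A f phi xs))%R%:E)%E.
  rewrite -sumEFin; apply: eq_bigr => w _; rewrite gap_in//.
  exact: D0.
rewrite -!EFinM lee_fin mulrCA ler_pM2l//.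
have mp : 0 < m.+1%:R :> R by rewrite ltr0n.
(* After multiplication by the epoch length, Jensen on each sample path reduces the claim to
   [main]. *)
rewrite -(ler_pM2l mp) mulrA [X in _ <= X * _]mulrC.
apply: le_trans main; rewrite exchange_big mulr_sumr; apply: ler_sum => w _.
rewrite avg sumrB sumr_const card_ord mulrBr [_ * psir A f phi xs]mulr_natl lerB//.
by rewrite -ler_pdivlMl//; case: (mean w).
Qed.
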